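(* If $c>C$, then the system $$\phi_i(\xi)=\int_{\mathbb R}\frac{(1+d_i)\phi_i(y)\,k_i(\xi-c-y)}{1+d_i\Big(\phi_i(y)+\sum_{j\in J'}e^i_j\phi_i(y-cj)+\sum_{j\in J,\,l\in I,\,l\ne i}f^i_{lj}\phi_l(y-cj+c)\Big)}\,dy,\qquad i\in I,\ \xi\in\mathbb R,$$ has a bounded positive solution $(\phi_1,\dots,\phi_m)$ satisfying $$0<\phi_i(\xi)<1\ \ (\xi\in\mathbb R),\qquad \lim_{\xi\to-\infty}\phi_i(\xi)e^{-\lambda_i^c\xi}=1,\qquad i\in I.$$
   Context: Let $m,\tau\in\mathbb N$, $I=\{1,\dots,m\}$, $J=\{1,\dots,\tau\}$, $J'=\{1,\dots,\tau-1\}$. The parameters $e^i_j$ ($i\in I,j\in J'$) and $f^i_{lj}$ ($i,l\in I$, $l\ne i$, $j\in J$) are nonnegative and $d_i>0$ for $i\in I$. Each kernel $k_i:\mathbb R\to[0,\infty)$ is Lebesgue measurable and integrable, even ($k_i(x)=k_i(-x)$), with $\int_{\mathbb R}k_i(y)\,dy=1$ and $\int_{\mathbb R}k_i(y)e^{\lambda y}dy<\infty$ for every $\lambda\ge0$. Solutions are bounded uniformly continuous functions $\mathbb R\to\mathbb R^m$. For $\lambda\ge0,c\ge0$ put $\Lambda_i(\lambda,c)=(1+d_i)\int_{\mathbb R}e^{\lambda y-\lambda c}k_i(y)\,dy$, and $$C=\max_{i\in I}\left\{\inf_{\lambda>0}\frac{\ln\left((1+d_i)\int_{\mathbb R}e^{\lambda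 y}k_i(y)\,dy\right)}{\lambda}\right\}.$$ For $c>C$ and $i\in I$, $\lambda_i^c>0$ denotes the number with $\Lambda_i(\lambda_i^c,c)=1$, $\Lambda_i(\lambda,c)>1$ for $\lambda\in(0,\lambda_i^c)$, and $\Lambda_i(\lambda,c)<1$ for $\lambda$ in some interval $(\lambda_i^c,\eta\lambda_i^c)$ with $\eta\in(1,2)$; i.e. $\lambda_i^c$ is the smallest positive root of $\Lambda_i(\cdot,c)=1$ . *)

(* Defs.v *)
From HB Require Import structures.
From mathcomp Require Import all_boot all_order all_algebra.
From mathcomp Require Import all_classical all_reals all_analysis.

Set Implicit Arguments.
Unset Strict Implicit.
Unset Printing Implicit Defensive.

Import Order.TTheory GRing.Theory Num.Theory.
Import numFieldNormedType.Exports.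

Local Open Scope classical_set_scope.
Local Open Scope ring_scope.

(* [lebesgue_measure] only knows the Borel sets; its completion lives on the
   sigma-algebra of all Lebesgue measurable sets.  [lebesgueType R] is
   convertible to [R], but carries that larger sigma-algebra. *)
Notation leb := completed_lebesgue_measure.
Notation lebesgueType R := (caratheodory_type ((@wlength R idfun)^*)%mu).

Definition dispersal_kernel (R : realType) (k : R -> R) : Prop :=
  [/\ forall x, 0 <= k x,
      measurable_fun [set: lebesgueType R] (k : lebesgueType R -> R) /\
      leb.-integrable [set: lebesgueType R] (EFin \o k),
      forall x, k x = k (- x),
      \int[leb]_y k y = 1 &
      forall lam, 0 <= lam -> (\int[leb]_y (k y * expR (lam * y))%:E < +oo)%E].

Definition Lambda (R : realType) (d : R) (k : R -> R) (lam c : R) : R :=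
  (1 + d) * \int[leb]_y (expR (lam * y - lam * c) * k y).

(* The constant C, in the extended reals so that neither the infimum nor the
   maximum needs a default value (-oo is neutral for the maximum). *)
Definition speed_bound (R : realType) (m : nat)
    (d : 'I_m -> R) (k : 'I_m -> R -> R) : \bar R :=
  \big[maxe/-oo%E]_(i < m)
    ereal_inf [set (ln ((1 + d i) * \int[leb]_y (expR (lam * y) * k i y)) / lam)%:E
              | lam in [set lam : R | 0 < lam]].

Definition is_lambda_c (R : realType) (d : R) (k : R -> R) (c l : R) : Prop :=
  [/\ 0 < l,
      Lambda d k l c = 1,
      forall lam, 0 < lam < l -> 1 < Lambda d k lam c &
      exists2 eta : R, 1 < eta < 2 &
        forall lam, l < lam < eta * l -> Lambda d k lam c < 1].

(* Definite description: "the number such that [is_lambda_c] holds"; such a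
   number is clearly unique, and it exists when c is larger than C. *)
Definition lambda_c (R : realType) (d : R) (k : R -> R) (c : R) : R :=
  xget 0 [set l | is_lambda_c d k c l].

(* e i j stands for e^i_j (used for 1 <= j <= tau - 1) and f i l j for
   f^i_{lj} (used for l != i and 1 <= j <= tau). *)
Definition denominator (R : realType) (m tau : nat) (d : 'I_m -> R)
    (e : 'I_m -> nat -> R) (f : 'I_m -> 'I_m -> nat -> R)
    (c : R) (phi : 'I_m -> R -> R) (i : 'I_m) (y : R) : R :=
  1 + d i * (phi i y
    + \sum_(1 <= j < tau) e i j * phi i (y - c * j%:R)
    + \sum_(1 <= j < tau.+1) \sum_(l < m | l != i)
        f i l j * phi l (y - c * j%:R + c)).

Definition wave_system (R : realType) (m tau : nat) (d : 'I_m -> R)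
    (e : 'I_m -> nat -> R) (f : 'I_m -> 'I_m -> nat -> R)
    (k : 'I_m -> R -> R) (c : R) (phi : 'I_m -> R -> R) : Prop :=
  forall (i : 'I_m) (xi : R),
    phi i xi = \int[leb]_y ((1 + d i) * phi i y * k i (xi - c - y)
                            / denominator tau d e f c phi i y).

(* Main.v *)
Require Import Defs.
From HB Require Import structures.
From mathcomp Require Import all_boot all_order all_algebra.
From mathcomp Require Import all_classical all_reals all_analysis.
From mathcomp Require Import measurable_realfun ring lra zify.

Set Implicit Arguments.
Unset Strict Implicit.
Unset Printing Implicit Defensive.

Import Order.TTheory GRing.Theory Num.Theory.
Import numFieldNormedType.Exports.

(** Write the right-hand side of the system as an operator [u |-> step u]: at [x] it averages, over the
    kernel centred at [x - c], the growth term [(1 + d) u / (1 + d (u + P))], where [P] collects the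
    competition felt by the species.  A wave profile is a fixed point of this operator.

    Two explicit barriers control the behaviour at minus infinity.  For [0 <= u <= 1] growth is at most [(1 + d) u]
    and at most 1, and averaging [exp (lam y)] multiplies it by [Lambda lam], which is 1 at [lam = lam_i]; hence
    [min (exp (lam_i x), 1)] is an upper barrier.  Growth is at least [(1 + d) (u - d u (u + P))], the
    quadratic error is at most a multiple of [exp ((lam_i + theta) y)] when [theta <= lam_l] for all [l],
    and [Lambda (lam_i + theta) < 1]; hence [max (0, exp (lam_i x) - q exp ((lam_i + theta) x))] is a lower
    barrier for large [q].  The bound on the error uses that competition at [y] only involves
    places up to [y] (because [c > 0]), where the upper barrier of every species is at most
    [exp (theta y)].

    The operator is not monotone, since competition lowers growth, so monotone iteration between the
    barriers would only give two coupled profiles.  A topological fixed point theorem is used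
    instead.  Every function [step u] has the modulus of continuity [h |-> || k (. + h) - k ||] in [L1], so
    the functions between the barriers with this modulus form a convex set, closed for pointwise
    convergence in a product of unit intervals, which [step] maps into itself (lemma [step_wave_set]) and on
    which it is continuous for pointwise convergence (lemma [step_ucontinuous]).

    Fixed points in such sets ([cube_fixed_point]) come from the argument of Schauder and
    Tychonoff: on finitely many points the set has a finite net, a partition of unity subordinate to
    it turns the operator into a map of a simplex, an approximate fixed point of the latter gives an
    approximate fixed point of the operator, and compactness (Tychonoff) gives an exact one.  The
    approximate fixed points on a simplex ([approx_brouwer]) come from a parity lemma of Scarf
    about a finite set with several linear orders ([scarf]), applied to the points of a fine
    grid ordered by their barycentric coordinates.

    Strict positivity and the strict bound by 1 hold near minus infinity by the barriers, and spread to
    the right by steps of length [c]: an even kernel has half of its mass on each side, so that the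
    value at [x] sees a positive mass of places to the left of [x - c].

    The kernels of the statement are only Lebesgue measurable.  They are first replaced by Borel
    kernels that differ from them on a null set, for which translations and reflections of the
    integral are available ([borel_kernel_version]). *)

(** * Scarf's lemma on finitely many linear orders *)

Section Scarf.
Variables (X T : finType) (r : T -> X -> nat).
Hypothesis r_inj : forall i, injective (r i).

(** A set [B] in [X + T] encodes the pair of the points [inl x] it contains and of the indices
    [i] such that [inr i] is NOT in it.  With this encoding dominance is inherited by subsets, and cells
    and their facets are simply sets with [#|T|] and [#|T|.-1] elements. *)
Definition dominant (B : {set X + T}) :=
  [forall x, exists i, (inr i \notin B) &&
     [forall y, (inl y \in B) ==> (r i x <= r i y)]].

Lemma dominantP (B : {set X + T}) :
  reflect (forall x, exists2 i, inr i \notin B &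
             forall y, inl y \in B -> r i x <= r i y) (dominant B).
Proof.
apply: (iffP forallP) => [H x|H x].
  have /existsP[i /andP[iB /forallP h]] := H x.
  by exists i => // y yB; have /implyP := h y; apply.
have [i iB h] := H x; apply/existsP; exists i; rewrite iB /=.
by apply/forallP => y; apply/implyP => /h.
Qed.

Lemma dominant_subset (A B : {set X + T}) :
  A \subset B -> dominant B -> dominant A.
Proof.
move=> /fintype.subsetP AB /dominantP H; apply/dominantP => x.
have [i iB h] := H x; exists i => [|y /AB]; last exact: h.
by apply: contra iB => /AB.
Qed.

Section Facet.
Variables (D : {set X + T}) (y0 : X).
Hypotheses (y0D : inl y0 \in D) (domD : dominant D) (cardD : #|D|.+1 = #|T|).

Let m i := [arg min_(y < y0 | inl y \in D) r i y].

Lemma minimizer_mem i : inl (m i) \in D.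
Proof. by rewrite /m; case: arg_minnP. Qed.

Lemma minimizer_le i y : inl y \in D -> r i (m i) <= r i y.
Proof. by rewrite /m; case: arg_minnP => // x _; apply. Qed.

Let I := [set i | inr i \notin D].
Let K := [set y | inl y \in D].

Lemma minimizer_unique i y : inl y \in D -> (forall y', inl y' \in D -> r i y <= r i y') ->
  y = m i.
Proof.
by move=> yD h; apply: (@r_inj i); apply/eqP; rewrite eqn_leq h ?minimizer_mem // minimizer_le.
Qed.

Lemma minimizer_cover y : inl y \in D -> exists2 i, i \in I & y = m i.
Proof.
move=> yD; have /dominantP/(_ y)[i iD h] := domD.
by exists i; rewrite ?inE //; apply: minimizer_unique.
Qed.

Lemma minimizer_image : m @: I = K.
Proof.
apply/setP => y; rewrite inE; apply/imsetP/idP => [[i _ ->]|/minimizer_cover//].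
exact: minimizer_mem.
Qed.

(** The set [D] has one element less than [T], so one more index is free than there are points: exactly
    two free indices share their minimizer. *)
Lemma card_free : #|I| = #|K|.+1.
Proof.
have cI : #|I| + #|~: I| = #|T| by rewrite cardsC.
have -> : #|I| = #|T| - #|~: I| by rewrite -cI addnK.
rewrite -cardD.
have -> : #|D| = #|K| + #|~: I|; last by rewrite -addSn addnK.
have -> : D = (inl @: K) :|: (inr @: (~: I)).
  apply/setP => -[y|i]; rewrite !inE.
    rewrite mem_imset; last by move=> ? ? [].
    by rewrite inE; apply/esym/orb_idr => /imsetP[].
  rewrite orbC mem_imset; last by move=> ? ? [].
  by rewrite !inE negbK; apply/esym/orb_idr => /imsetP[].
rewrite cardsU disjoint_setI0.
  by rewrite cards0 subn0 !card_imset // => ? ? [].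
by apply/pred0P => -[y|i] /=; apply/negP => /andP[/imsetP[? _ h1] /imsetP[? _ h2]].
Qed.

(** Dropping one of two indices with the same minimizer keeps the image [K], which then has as many
    elements as there are indices left. *)
Lemma minimizer_inj i j : i \in I -> j \in I -> i != j -> m i = m j ->
  {in I :\ i &, injective m}.
Proof.
move=> iI jI ij e; apply/imset_injP.
have -> : m @: (I :\ i) = K.
  rewrite -minimizer_image; apply/setP => y; apply/imsetP/imsetP => -[l].
    by rewrite in_setD1 => /andP[_ lI] ->; exists l.
  move=> lI ->; have [->|li] := eqVneq l i; last by exists l; rewrite // in_setD1 li.
  by exists j; rewrite // in_setD1 eq_sym ij.
by have := cardsD1 i I; rewrite iI card_free add1n => -[->].
Qed.

Lemma shared_minimizer : exists i1 i2, [/\ i1 \in I, i2 \in I, i1 != i2, m i1 = m i2 &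
  forall i j, i \in I -> j \in I -> i != j -> m i = m j -> (i == i1) || (i == i2)].
Proof.
have /dinjectivePn[i1 i1I [i2 /andP[/= ne i2I] e]] : ~~ dinjectiveb m I.
  apply/negP => /dinjectiveP/card_in_imset; rewrite minimizer_image card_free => /eqP.
  by rewrite ltn_eqF.
exists i1, i2; split=> //; first by rewrite eq_sym.
move=> i j iI jI ij e'; apply: contraT; rewrite negb_or => /andP[ii1 ii2].
have := minimizer_inj iI jI ij e'.
move/(_ i1 i2); rewrite !in_setD1 i1I i2I eq_sym ii1 eq_sym ii2 => /(_ isT isT e) ei.
by rewrite ei eqxx in ne.
Qed.

(** How a coface of [D] can settle the conflict of two indices sharing a minimizer: the index [i] is
    given up, or a point beating all other minimizers becomes the minimizer for [i]. *)
Let replaces i z := match z with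
  | inl x => [forall j, (j \in I) && (j != i) ==> (r j (m j) < r j x)]
  | inr j => j == i end.

Lemma replacesP i x : reflect (forall j, j \in I -> j != i -> r j (m j) < r j x) (replaces i (inl x)).
Proof.
apply: (iffP forallP) => [h j jI ji|h j]; first by have /implyP := h j; apply; rewrite jI.
by apply/implyP => /andP[]; exact: h.
Qed.

(** Two points that could replace the minimizer for [i] dominate each other in the order [i], as no
    other index can bound them; and giving up [i] leaves no index to bound such a point. *)
Lemma replaces_unique i z z' : z \notin D -> z' \notin D -> dominant (z |: D) ->
  dominant (z' |: D) -> replaces i z -> replaces i z' -> z = z'.
Proof.
wlog : z z' / if z is inl _ then true else if z' is inr _ then true else false.
  case: z => [x|j]; case: z' => [x'|j'] h h1 h2 h3 h4 h5 h6; try exact: h.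
  by apply/esym; apply: h.
have aux x w : inl x \notin D -> dominant (w |: D) -> replaces i w -> replaces i (inl x) ->
    exists x', w = inl x' /\ r i x <= r i x'.
  move=> xD /dominantP/(_ x)[j]; rewrite in_setU1 negb_or => /andP[jw jD] h ti /replacesP tx.
  have jI : j \in I by rewrite inE.
  have hj : j = i.
    apply/eqP; apply: contraT => ji; have := tx _ jI ji.
    by rewrite ltnNge h // in_setU1 minimizer_mem orbT.
  case: w jw h ti => [x' _ h _|j' jw _ /eqP ej].
    by exists x'; split => //; rewrite -hj; apply: h; rewrite in_setU1 eqxx.
  by move: jw; rewrite hj ej eqxx.
case: z => [x|j].
  move=> _ xD z'D dx dz' tx tz'.
  have [x' [ez' le1]] := aux _ _ xD dz' tz' tx.
  move: z'D dz' tz'; rewrite ez' => x'D dx' tx'.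
  have [x'' [[<-] le2]] := aux _ _ x'D dx tx tx'.
  by congr inl; apply: (@r_inj i); apply/eqP; rewrite eqn_leq le1 le2.
case: z' => // j'.
by move=> _ _ _ _ _ /eqP-> /eqP->.
Qed.

(** Take the best candidate in the order [i]; if there is none, dominance survives without [i]. *)
Lemma replaces_exists i j : i \in I -> j \in I -> i != j -> m i = m j ->
  exists z, [/\ z \notin D, dominant (z |: D) & replaces i z].
Proof.
move=> iI jI ij e.
have [x0 tx0|no] := pickP (fun x => replaces i (inl x)); last first.
  exists (inr i); split => /=; rewrite ?eqxx //; first by rewrite inE in iI.
  apply/dominantP => x; have /negbT := no x; rewrite negb_forall => /existsP[l].
  rewrite negb_imply -leqNgt inE => /andP[/andP[lD li] lx].
  exists l; first by rewrite in_setU1 negb_or lD andbT; apply: contra li => /eqP[->].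
  by move=> y; rewrite in_setU1 => /= yD; apply: (leq_trans lx); exact: minimizer_le.
pose x := [arg max_(x > x0 | replaces i (inl x)) r i x].
have [tx xmax] : replaces i (inl x) /\ forall y, replaces i (inl y) -> r i y <= r i x.
  by rewrite /x; case: arg_maxnP.
have tx' := replacesP _ _ tx.
exists (inl x); split => //.
  apply/negP => /minimizer_cover[l lI xl].
  have [li|li] := eqVneq l i.
    by have := tx' _ jI; rewrite eq_sym ij -e -li -xl => /(_ isT); rewrite {2}xl li e ltnNge minimizer_le // xl; exact: minimizer_mem.
  by have := tx' _ lI li; rewrite xl ltnn.
apply/dominantP => y.
have [l lD hl] := dominantP _ domD y.
have lI : l \in I by rewrite inE.
have [ty|] := boolP (replaces i (inl y)).
  have li : l = i.
    apply/eqP; apply: contraT => li; have := replacesP _ _ ty _ lI li.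
    by rewrite ltnNge hl // minimizer_mem.
  have [l' l'D hl'] := dominantP _ domD x.
  have l'i : l' = i.
    apply/eqP; apply: contraT => li'; have := tx' l'; rewrite inE l'D => /(_ isT li').
    by rewrite ltnNge hl' // minimizer_mem.
  exists l; first by rewrite in_setU1 negb_or /= lD.
  move=> w; rewrite in_setU1 => /orP[/eqP[->]|]; last exact: hl.
  by rewrite li xmax.
rewrite negb_forall => /existsP[q]; rewrite negb_imply -leqNgt inE => /andP[/andP[qD qi] qy].
have qI : q \in I by rewrite inE.
exists q; first by rewrite in_setU1 negb_or /= qD.
move=> w; rewrite in_setU1 => /orP[/eqP[->]|wD]; apply: (leq_trans qy); last exact: minimizer_le.
by apply: ltnW; apply: tx'.
Qed.

(** In a dominant set with [#|T|] elements every point is the minimizer of exactly one free index, so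
    a new element must resolve the coincidence at [i1] or at [i2]. *)
Lemma cofaces_replace i1 i2 z : i1 \in I -> i2 \in I -> i1 != i2 -> m i1 = m i2 ->
  (forall i j, i \in I -> j \in I -> i != j -> m i = m j -> (i == i1) || (i == i2)) ->
  z \notin D -> dominant (z |: D) -> replaces i1 z || replaces i2 z.
Proof.
move=> i1I i2I i12 e12 pair zD dz.
case: z zD dz => [x xD dx|j jD dz].
  have [i iD hi] := dominantP _ dx x.
  have {}iI : i \in I by move: iD; rewrite in_setU1 inE negb_or => /andP[].
  have lt_i y : inl y \in D -> r i x < r i y.
    move=> yD; rewrite ltn_neqAle hi ?in_setU1 ?yD ?orbT // andbT.
    by apply: contraNneq xD => /r_inj->.
  have [i' [i'I i'i ei']] : exists i', [/\ i' \in I, i != i' & m i = m i'].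
    have [i' i'D hi'] := dominantP _ dx (m i).
    have i'I : i' \in I by move: i'D; rewrite in_setU1 inE negb_or => /andP[].
    exists i'; split => //; last first.
      apply: minimizer_unique => [|y yD]; first exact: minimizer_mem.
      by apply: hi'; rewrite in_setU1 yD orbT.
    have := hi' x; rewrite in_setU1 eqxx => /(_ isT).
    by apply: contraTneq => <-; rewrite -ltnNge; apply/lt_i/minimizer_mem.
  suff ti : replaces i (inl x).
    by have /orP[/eqP <-|/eqP <-] := pair _ _ iI i'I i'i ei'; rewrite ti ?orbT.
  apply/replacesP => j jI ji; rewrite ltnNge; apply/negP => jx.
  (* i and j would both have x as minimizer, leaving #|K|.-1 indices to cover K *)
  suff : #|K| < #|K| by rewrite ltnn.
  have : K \subset m @: (I :\ i :\ j).
    apply/fintype.subsetP => y; rewrite inE => yD.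
    have [l lD hl] := dominantP _ dx y.
    have lI : l \in I by move: lD; rewrite in_setU1 inE negb_or => /andP[].
    have lx : r l y < r l x.
      rewrite ltn_neqAle hl ?in_setU1 ?eqxx // andbT.
      by apply: contraNneq xD => /r_inj<-.
    apply/imsetP; exists l.
      rewrite in_setD1 in_setD1 lI andbT; apply/andP; split.
        apply: contraTneq lx => ->; rewrite -leqNgt; apply: (leq_trans jx); exact: minimizer_le.
      by apply: contraTneq lx => ->; rewrite -leqNgt hi // in_setU1 yD orbT.
    by apply: minimizer_unique => // w wD; apply: hl; rewrite in_setU1 wD orbT.
  move/subset_leq_card => /leq_ltn_trans; apply.
  apply: (leq_ltn_trans (leq_imset_card _ _)).
  have := cardsD1 i I; rewrite iI card_free add1n => -[->].
  by rewrite (cardsD1 j (I :\ i)) in_setD1 ji jI /= add1n ltnS.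
have jI : j \in I by rewrite inE.
have [i' i'D hi'] := dominantP _ dz (m j).
have /andP[i'j i'I] : (i' != j) && (i' \in I).
  move: i'D; rewrite in_setU1 inE negb_or => /andP[h ->]; rewrite andbT.
  by apply: contra h => /eqP->.
have ej : m j = m i'.
  apply: minimizer_unique => [|y yD]; first exact: minimizer_mem.
  by apply: hi'; rewrite in_setU1 yD orbT.
by rewrite /=; apply: (pair _ _ jI i'I _ ej); rewrite eq_sym.
Qed.

(** The pseudomanifold property: one coface for each of the two indices sharing their minimizer. *)
Lemma card_dominant_cofaces : #|[set z | (z \notin D) && dominant (z |: D)]| = 2.
Proof.
have [i1 [i2 [i1I i2I i12 e12 pair]]] := shared_minimizer.
have [z1 [z1D dz1 t1]] := replaces_exists i1I i2I i12 e12.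
have [z2 [z2D dz2 t2]] : exists z, [/\ z \notin D, dominant (z |: D) & replaces i2 z].
  by apply: (replaces_exists i2I i1I); rewrite 1?eq_sym.
have z12 : z1 != z2.
  apply/eqP => ez; rewrite -ez in t2; case: z1 t1 t2 {z1D dz1 ez} => [x|j]; last first.
    by move=> /= /eqP e1 /eqP e2; rewrite -e1 e2 eqxx in i12.
  move=> /replacesP h1 /replacesP h2.
  have [j jD hj] := dominantP _ domD x.
  have jI : j \in I by rewrite inE.
  have [ji|ji] := eqVneq j i1.
    have := h2 _ jI; rewrite ji i12 => /(_ isT).
    by rewrite ltnNge -ji hj // minimizer_mem.
  by have := h1 _ jI ji; rewrite ltnNge hj // minimizer_mem.
suff -> : [set z | (z \notin D) && dominant (z |: D)] = [set z1; z2] by rewrite cards2 z12.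
apply/setP => z; rewrite !inE; apply/andP/orP => [[zD dz]|[]/eqP->]//.
have /orP[t|t] := cofaces_replace i1I i2I i12 e12 pair zD dz.
  by left; apply/eqP; apply: replaces_unique t t1.
by right; apply/eqP; apply: replaces_unique t t2.
Qed.

End Facet.

Section Parity.
Variables (x0 : X) (t0 : T) (c : X -> T).

(** Giving each element of [T] its own colour makes a cell rainbow exactly when its points show all
    the free indices. *)
Let col z := match z with inl x => c x | inr t => t end.

Let missing (D : {set X + T}) := (#|D|.+1 == #|T|) && (col @: D == [set~ t0]).

Let cell (B : {set X + T}) := (#|B| == #|T|) && dominant B.

Let root : {set X + T} := [set inr t | t in [set~ t0]].

Lemma mem_root t : (inr t \in root) = (t != t0).
Proof. by rewrite /root mem_imset ?inE // => ? ? []. Qed.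

Let cofaces (D : {set X + T}) := #|[set z | (z \notin D) && dominant (z |: D)]|.

Lemma missing_root : missing root.
Proof.
rewrite /missing card_imset; last by move=> ? ? [].
have T0 : 0 < #|T| by apply/card_gt0P; exists t0.
rewrite cardsC1 prednK // eqxx /=; apply/eqP/setP => t.
apply/imsetP/idP => [[_ /imsetP[s sT ->] ->]//|tT].
by exists (inr t) => //; apply: imset_f.
Qed.

(** The facet [root] contains no point; its only dominant coface adds the maximum of the order [t0]. *)
Lemma cofaces_root : cofaces root = 1.
Proof.
have dom_inl x : dominant (inl x |: root) = [forall y, r t0 y <= r t0 x].
  apply/dominantP/forallP => [h y|h y].
    have [i] := h y; rewrite in_setU1 mem_root /= negbK => /eqP-> /(_ x).
    by rewrite in_setU1 eqxx; apply.
  exists t0; first by rewrite in_setU1 mem_root /= eqxx.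
  move=> w; rewrite in_setU1 => /orP[/eqP[->]//|]; by move=> /imsetP[].
pose x := [arg max_(x > x0) r t0 x].
have xmax y : r t0 y <= r t0 x by rewrite /x; case: arg_maxnP => // ? _; apply.
rewrite /cofaces -(cards1 (inl x : X + T)); congr #|pred_of_set _|.
apply/setP => -[y|t]; rewrite !inE.
  have -> : inl y \notin root by apply/negP => /imsetP[].
  rewrite dom_inl /=; apply/forallP/eqP => [h|[->]//].
  by congr inl; apply: (@r_inj t0); apply/eqP; rewrite eqn_leq xmax h.
rewrite mem_root negbK andbC; apply/negP => /andP[/dominantP/(_ x0)[i]].
rewrite in_setU1 mem_root negb_or negbK => /andP[h /eqP ei] _ /eqP et.
by case/eqP: h; rewrite ei et.
Qed.

Lemma cofaces_even D : missing D -> D != root -> ~~ odd (cofaces D).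
Proof.
move=> /andP[/eqP cD /eqP colD] DD0.
have [/existsP[y yD]|noy] := boolP [exists y, inl y \in D].
  have [dD|ndD] := boolP (dominant D); first by rewrite /cofaces (card_dominant_cofaces yD dD cD).
  rewrite /cofaces (_ : [set z | _] = finset.set0) ?cards0 //.
  apply/setP => z; rewrite !inE; apply/negP => /andP[_ dz].
  by case/negP: ndD; apply: dominant_subset dz; apply: subsetU1.
case/eqP: DD0; apply/setP => -[y|t].
  have -> : inl y \in root = false by apply/negP => /imsetP[].
  by apply: contraNF noy => yD; apply/existsP; exists y.
rewrite mem_root -in_setC1 -colD; apply/idP/imsetP => [tD|[[y|t'] zD /= ->]//].
  by exists (inr t).
by case/negP: noy; apply/existsP; exists y.
Qed.

Let facets (B : {set X + T}) := #|[set z in B | missing (B :\ z)]|.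

(** If a cell that is not rainbow has a facet missing only the colour [t0], its remaining element
    repeats a colour of that facet, and exactly these two elements can be left out. *)
Lemma facets_even (B : {set X + T}) : #|B| = #|T| -> col @: B != finset.setT -> ~~ odd (facets B).
Proof.
move=> cB nr; rewrite /facets.
have [/existsP[z /andP[zB mz]]|no] := boolP [exists z, (z \in B) && missing (B :\ z)]; last first.
  rewrite (_ : [set z in B | _] = finset.set0) ?cards0 //; apply/setP => z; rewrite !inE.
  by apply: contraNF no => h; apply/existsP; exists z.
have /andP[/eqP cz /eqP colz] := mz.
have inj : {in B :\ z &, injective col}.
  by apply/imset_injP; rewrite colz cardsC1 -cz.
have cz0 : col z != t0.
  apply: contra nr => /eqP e; apply/eqP/setP => t; rewrite finset.in_setT.
  have [->|tt0] := eqVneq t t0; first by rewrite -e; apply: imset_f.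
  have : t \in col @: (B :\ z) by rewrite colz in_setC1.
  by move=> /imsetP[w]; rewrite in_setD1 => /andP[_ wB] ->; apply: imset_f.
have : col z \in col @: (B :\ z) by rewrite colz in_setC1.
move=> /imsetP[z']; rewrite in_setD1 => /andP[z'z z'B] ezz'.
suff -> : [set z in B | missing (B :\ z)] = [set z; z'] by rewrite cards2 eq_sym z'z.
apply/setP => w; rewrite !inE; apply/andP/orP => [[wB /andP[_ /eqP colw]]|].
  apply/orP; apply: contraT; rewrite negb_or => /andP[wz wz'].
  have : col w \in col @: (B :\ z) by apply: imset_f; rewrite in_setD1 wz.
  rewrite colz -colw => /imsetP[u]; rewrite in_setD1 => /andP[uw uB] ewu.
  have [uz|uz] := eqVneq u z.
    move: wz'; rewrite (inj w z') ?eqxx ?in_setD1 ?wz ?z'z ?wB //.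
    by rewrite ewu uz.
  by move: uw; rewrite (inj w u) ?eqxx ?in_setD1 ?wz ?uz ?uB.
case=> /eqP->; first by split.
split => //; rewrite /missing; apply/andP; split.
  by rewrite -cB (cardsD1 z' B) z'B.
rewrite -colz; apply/eqP/setP => t; apply/imsetP/imsetP => -[u]; rewrite in_setD1 => /andP[un uB] ->.
  have [->|uz] := eqVneq u z; first by exists z'; rewrite // in_setD1 z'z.
  by exists u; rewrite // in_setD1 uz.
have [->|uz] := eqVneq u z'; first by exists z; rewrite // in_setD1 eq_sym z'z.
by exists u; rewrite // in_setD1 uz.
Qed.

Lemma sum_incidences :
  \sum_(D | missing D) cofaces D = \sum_(B | cell B) facets B.
Proof.
transitivity (\sum_z \sum_(D | missing D && ((z \notin D) && dominant (z |: D))) 1).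
  rewrite (exchange_big_dep missing) => [|z D _ /andP[]//] /=.
  apply: eq_bigr => D mD; rewrite /cofaces -sum1_card; apply: eq_bigl => z.
  by rewrite inE mD.
transitivity (\sum_z \sum_(B | cell B && ((z \in B) && missing (B :\ z))) 1); last first.
  rewrite (exchange_big_dep cell) => [|z D _ /andP[]//] /=.
  apply: eq_bigr => D mD; rewrite /facets -sum1_card; apply: eq_bigl => z.
  by rewrite inE mD.
apply: eq_bigr => z _.
rewrite (reindex_onto (fun B => B :\ z) (fun D => z |: D)); last first.
  by move=> D /andP[_ /andP[zD _]]; rewrite setU1K.
apply: eq_bigl => B; rewrite /cell in_setD1 eqxx /=.
have [zB|zB] := boolP (z \in B); last first.
  by rewrite andbF; apply/negbTE; apply: contra zB => /andP[_ /eqP <-]; rewrite setU11.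
rewrite finset.setD1K // eqxx andbT.
have [mB|] := boolP (missing _); last by rewrite /= !andbF.
have /andP[/eqP cB _] := mB.
by rewrite -cB [in RHS](cardsD1 z B) zB add1n eqxx !andbT.
Qed.

(** Counting incidences between facets missing [t0] and cells in two ways: facets contribute an even
    number except for the root, cells an even number unless they are rainbow. *)
Theorem scarf : exists B : {set X + T}, [/\ #|B| = #|T|, dominant B &
  forall t, inr t \notin B -> exists2 x, inl x \in B & c x = t].
Proof.
have [/existsP[B /and3P[/eqP cB dB /eqP colB]]|no] :=
    boolP [exists B : {set X + T}, [&& #|B| == #|T|, dominant B & col @: B == finset.setT]].
  exists B; split => // t tB; have : t \in col @: B by rewrite colB inE.
  by move=> /imsetP[[x|t'] zB /= e]; [exists x | rewrite e zB in tB].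
suff : odd (\sum_(D | missing D) cofaces D).
  rewrite sum_incidences; suff -> : odd (\sum_(B | cell B) facets B) = false by [].
  apply: (big_ind (fun n => odd n = false)) => // [a b|B /andP[/eqP cB dB]].
    by rewrite oddD => -> ->.
  apply/negbTE/facets_even => //; apply: contra no => e; apply/existsP; exists B.
  by rewrite cB eqxx dB.
rewrite (bigD1 root missing_root) oddD cofaces_root.
suff -> : odd (\sum_(D | missing D && (D != root)) cofaces D) = false by [].
apply: (big_ind (fun n => odd n = false)) => // [a b|D /andP[mD DD0]].
  by rewrite oddD => -> ->.
by apply/negbTE/cofaces_even.
Qed.

End Parity.
End Scarf.

(** * Approximate fixed points on a simplex *)

Section Grid.
Variables (T : finType) (t0 : T) (N : nat).

(** Points of a simplex whose barycentric coordinates are multiples of [1 / N], scaled by [N]. *)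
Definition grid := {g : {ffun T -> 'I_N.+1} | \sum_t g t == N}.

Lemma grid_of (g : T -> nat) : \sum_t g t = N ->
  {x : grid | forall t, val x t = g t :> nat}.
Proof.
move=> sg; have gN t : g t < N.+1 by rewrite ltnS -sg (bigD1 t) //= leq_addr.
have hx : \sum_t [ffun t => Ordinal (gN t)] t == N.
  by rewrite -[X in _ == X]sg; apply/eqP/eq_bigr => t _; rewrite ffunE.
by exists (exist (fun g : {ffun T -> 'I_N.+1} => \sum_t g t == N) _ hx) => t /=; rewrite ffunE.
Qed.

(** The coordinate [t], with ties broken by an enumeration so as to get a linear order. *)
Let rank (t : T) (x : grid) : nat := val x t * #|{: grid}| + enum_rank x.

Lemma rank_inj t : injective (rank t).
Proof.
move=> x y; rewrite /rank => e; apply: enum_rank_inj; apply: val_inj.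
have := congr1 (modn^~ #|{: grid}|) e.
by rewrite /= !modnMDl !modn_small // ltn_ord.
Qed.

Lemma rank_lt t (x y : grid) : val x t < val y t -> rank t x < rank t y.
Proof.
move=> xy; rewrite /rank; apply: (@leq_trans ((val x t).+1 * #|{: grid}|)).
  by rewrite mulSn addnC ltn_add2r ltn_ord.
by rewrite (leq_trans _ (leq_addr _ _)) // leq_mul2r xy orbT.
Qed.

(** Dominance makes the minimal coordinates of a rainbow cell add up to nearly [N]: otherwise a grid point
    exceeding all of them would exist.  Hence all points of the cell are close to each other, and nearly
    vanish at the coordinates in which the cell is not free. *)
Lemma grid_rainbow (c : grid -> T) : exists (I : {set T}) (K : {set grid}),
  [/\ K != finset.set0, forall t, t \in I -> exists2 x, x \in K & c x = t,
      forall x y t, x \in K -> y \in K -> val x t < val y t + #|T| &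
      forall x t, x \in K -> t \notin I -> val x t < #|T|].
Proof.
have [x0 _] : {x : grid | forall t, val x t = (if t == t0 then N else 0) :> nat}.
  by apply: grid_of; rewrite -big_mkcond big_pred1_eq.
have [B [cB dB colB]] := scarf rank_inj x0 t0 c.
pose I := [set t | inr t \notin B]; pose K := [set x | inl x \in B].
have [i0 i0B _] := dominantP _ _ dB x0.
have i0I : i0 \in I by rewrite inE.
have [y0 y0B _] := colB _ i0B.
pose m t := [arg min_(y < y0 | inl y \in B) rank t y].
have mB t : inl (m t) \in B by rewrite /m; case: arg_minnP.
have m_min t y : inl y \in B -> val (m t) t <= val y t.
  move=> yB; rewrite leqNgt; apply/negP => /rank_lt.
  by rewrite ltnNge /m; case: arg_minnP => // z _ ->.
have sumI : N < \sum_(t in I) (val (m t) t).+1.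
  rewrite ltnNge; apply/negP => le.
  (* the remainder N - s is put on the coordinate i0 to stay on the grid *)
  pose s := \sum_(t in I) (val (m t) t).+1.
  pose g t := if t \in I then (val (m t) t).+1 + (if t == i0 then N - s else 0) else 0.
  have [x hx] : {x : grid | forall t, val x t = g t :> nat}.
    apply: grid_of; rewrite -big_mkcond big_split /= -/s.
    rewrite (bigD1 i0) //= eqxx big1 ?addn0 ?subnKC //.
    by move=> t /andP[_ /negbTE->].
  have [t tB /(_ _ (mB t))] := dominantP _ _ dB x.
  apply/negP; rewrite -ltnNge; apply: rank_lt.
  by rewrite hx /g inE tB; apply: leq_addr.
have sumIx x : inl x \in B -> \sum_(t in I) val x t <= N.
  move=> xB; apply: (@leq_trans (\sum_t val x t)); last by rewrite (eqP (valP x)).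
  by rewrite [leqRHS](bigID (fun t => t \in I)) /= leq_addr.
have cI : #|I| <= #|T| by apply: max_card.
have sumIE : \sum_(t in I) (val (m t) t).+1 = \sum_(t in I) val (m t) t + #|I|.
  rewrite -sum1_card -big_split /=; apply: eq_bigr => t _; by rewrite addn1.
have offI x t : inl x \in B -> t \notin I -> val x t < #|T|.
  move=> xB tI; have /eqP := valP x; rewrite (bigID (fun t => t \in I)) /=.
  rewrite [X in _ + X](bigD1 t) //= => sx.
  have : \sum_(i in I) val (m i) i <= \sum_(i in I) val x i.
    by apply: leq_sum => i _; apply: m_min.
  have aux (a b i d v n : nat) :
    a <= b -> N < a + i -> b + (v + d) = N -> i <= n -> v < n by lia.
  by move=> le1; apply: (aux _ _ _ _ _ _ le1 _ sx cI); rewrite -sumIE.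
exists I, K; split.
- by apply/set0Pn; exists y0; rewrite inE.
- by move=> t; rewrite inE => /colB[x xB <-]; exists x; rewrite ?inE.
- move=> x y t; rewrite !inE => xB yB; have [tI|tI] := boolP (t \in I); last first.
    by apply: leq_trans (offI _ _ xB tI) _; rewrite leq_addl.
  have aux (a b i mt xt yt n : nat) : N < mt + a + i -> xt + b <= N -> mt <= yt ->
    a <= b -> i <= n -> xt < yt + n by lia.
  apply: (aux _ _ _ _ _ _ _ _ _ (m_min t y yB) _ cI).
  - by have := sumI; rewrite sumIE (bigD1 t) //=; apply.
  - by have := sumIx _ xB; rewrite (bigD1 t) //=; apply.
  - by apply: leq_sum => i _; apply: m_min.
- by move=> x t; rewrite inE; apply: offI.
Qed.

End Grid.

Local Open Scope classical_set_scope.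
Local Open Scope ring_scope.

Section Brouwer.
Variables (R : realType) (T : finType).

Definition simplex (x : T -> R) := (forall t, 0 <= x t) /\ \sum_t x t = 1.

(** Colour a grid point by a coordinate that [w] does not decrease.  On a small rainbow cell [w] then
    decreases no coordinate by much, and since coordinates add up to 1 it increases none by much. *)
Lemma approx_brouwer (w : (T -> R) -> (T -> R)) :
  (exists x, simplex x) ->
  (forall x, simplex x -> simplex (w x)) ->
  (forall e : R, 0 < e -> exists2 d : R, 0 < d & forall x y, simplex x -> simplex y ->
     (forall t, `|x t - y t| < d) -> forall t, `|w x t - w y t| < e) ->
  forall e : R, 0 < e -> exists2 x, simplex x & forall t, `|w x t - x t| <= e.
Proof.
move=> [x1 [_ sx1]] wS wc e e0.
have [t0 _] : exists t0 : T, True.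
  have [//|none] := pselect (exists t0 : T, True).
  by move: sx1; rewrite big1 => [/eqP|t]; [rewrite eq_sym oner_eq0 | case: none; exists t].
pose n := #|T|.
have n0 : 0 < n%:R :> R by rewrite ltr0n /n (cardD1 t0).
pose e' := e / (2 * n%:R).
have e'0 : 0 < e' by rewrite divr_gt0 // mulr_gt0.
have [d d0 wd] := wc _ e'0.
pose N := (Num.trunc (n%:R / Num.min d e')).+1.
have md : 0 < Num.min d e' by rewrite lt_min d0.
have N0 : 0 < N%:R :> R by rewrite ltr0n.
have nN : n%:R / N%:R < Num.min d e'.
  by rewrite ltr_pdivrMr // mulrC -ltr_pdivrMr // truncnS_gt.
have {nN}[nd ne] : n%:R / N%:R < d /\ n%:R / N%:R < e'.
  by move: nN; rewrite lt_min => /andP[].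
pose pt (g : grid T N) t : R := (val g t)%:R / N%:R.
have ptS g : simplex (pt g).
  split=> [t|]; first by rewrite divr_ge0.
  rewrite -mulr_suml -natr_sum; have /eqP -> := valP g.
  by rewrite divff // gt_eqF.
have /choice[c hc] : forall g, exists t, pt g t <= w (pt g) t.
  move=> g; apply/not_existsP => h.
  have [_ s1] := ptS g; have [_ s2] := wS _ (ptS g).
  suff : \sum_t w (pt g) t < \sum_t pt g t by rewrite s1 s2 ltxx.
  apply: ltr_sum => [|t _]; first by apply/hasP; exists t0; rewrite ?mem_index_enum.
  by rewrite ltNge; apply/negP; apply: h.
have [I [K [/set0Pn[x xK] colI closeK offK]]] := grid_rainbow t0 c.
have lt_pt (a b : nat) : (a < b + n)%N -> a%:R / N%:R < b%:R / N%:R + n%:R / N%:R :> R.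
  by move=> ab; rewrite -mulrDl ltr_pM2r ?invr_gt0 // -natrD ltr_nat.
have near y t : y \in K -> `|pt x t - pt y t| < n%:R / N%:R.
  move=> yK; rewrite ltr_distl; apply/andP; split; rewrite ?ltrBlDr.
    by apply: lt_pt; apply: closeK.
  by apply: lt_pt; apply: closeK.
have lower t : pt x t - 2 * e' <= w (pt x) t.
  have [tI|tI] := boolP (t \in I).
    have [y yK cy] := colI _ tI.
    have := hc y; rewrite cy => h1.
    have := near y t yK; rewrite ltr_norml => /andP[_ h2].
    have : `|w (pt x) t - w (pt y) t| < e'.
      by apply: wd => // s; apply: lt_trans nd; apply: near.
    rewrite ltr_norml => /andP[h3 _].
    lra.
  have := offK _ _ xK tI; rewrite -[X in (_ < X)%N]add0n => /lt_pt.
  rewrite mul0r add0r -/(pt x t) => h1.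
  have [/(_ t) h2 _] := wS _ (ptS x).
  lra.
exists (pt x) => // t.
rewrite ler_norml; apply/andP; split.
  have n1 : 1 <= n%:R :> R by rewrite ler1n /n (cardD1 t0).
  have : 2 * e' <= e.
    have -> : 2 * e' = e / n%:R by rewrite /e'; field; rewrite gt_eqF.
    by rewrite ler_pdivrMr // ler_peMr // ltW.
  by have := lower t; lra.
have [_ s1] := ptS x; have [_ s2] := wS _ (ptS x).
move: s2; rewrite -s1 (bigD1 t) //= [RHS](bigD1 t) //= => s2.
have : \sum_(i | i != t) pt x i - \sum_(i | i != t) w (pt x) i <= e.
  rewrite -sumrB; apply: (@le_trans _ _ (\sum_(i : T) 2 * e')).
    rewrite [leRHS](bigD1 t) //= -[leLHS]add0r lerD //; first by rewrite mulr_ge0 // ltW.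
    by apply: ler_sum => i _; have := lower i; lra.
  rewrite sumr_const -/n -mulr_natr /e'.
  by rewrite le_eqVlt; apply/orP; left; apply/eqP; field; rewrite gt_eqF.
lra.
Qed.

End Brouwer.

(** * Fixed points in compact convex sets of functions *)

Section Schauder.
Variables (R : realType) (S : eqType).

(** Uniform continuity for the uniform structure of pointwise convergence. *)
Definition pointwise_ucontinuous (K : set (S -> R)) (F : (S -> R) -> S -> R) :=
  forall s (e : R), 0 < e -> exists (Q : seq S) (d : R), 0 < d /\
    forall u v, K u -> K v -> (forall q, q \in Q -> `|u q - v q| < d) ->
      `|F u s - F v s| < e.

(** Closedness in the product topology, in terms of approximations at finitely many points. *)
Definition pointwise_closed (K : set (S -> R)) := forall u : S -> R,
  (forall (P : seq S) (e : R), 0 < e ->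
     exists2 v, K v & forall p, p \in P -> `|u p - v p| < e) -> K u.

Definition convex_closed (K : set (S -> R)) :=
  forall (T : finType) (x : T -> R) (v : T -> S -> R), simplex x ->
    (forall t, K (v t)) -> K (fun s => \sum_t x t * v t s).

Lemma pointwise_ucontinuous_seq (K : set (S -> R)) F (P : seq S) (e : R) :
  pointwise_ucontinuous K F -> 0 < e -> exists (Q : seq S) (d : R), 0 < d /\
    forall u v, K u -> K v -> (forall q, q \in Q -> `|u q - v q| < d) ->
      forall p, p \in P -> `|F u p - F v p| < e.
Proof.
move=> Fc e0; elim: P => [|p P [Q [d [d0 Qd]]]]; first by exists [::], 1.
have [Q' [d' [d'0 Qd']]] := Fc p _ e0.
exists (Q ++ Q'), (Num.min d d'); split; first by rewrite lt_min d0.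
move=> u v Ku Kv uv q; rewrite in_cons => /orP[/eqP->|qP].
  by apply: Qd' => // s sQ; have := uv s; rewrite mem_cat sQ orbT lt_min => /(_ isT) /andP[].
by apply: Qd => // s sQ; have := uv s; rewrite mem_cat sQ lt_min => /(_ isT) /andP[].
Qed.

Variables (K : set (S -> R)) (F : (S -> R) -> S -> R).
Hypotheses (K0 : K !=set0) (K01 : forall u, K u -> forall s, 0 <= u s <= 1).
Hypotheses (Kconv : convex_closed K) (KF : forall u, K u -> K (F u)).
Hypothesis Fc : pointwise_ucontinuous K F.

Definition dist_on (P : seq S) (u v : S -> R) := \sum_(p <- P) `|u p - v p|.

Lemma le_dist_on P u v p : p \in P -> `|u p - v p| <= dist_on P u v.
Proof.
move=> pP; rewrite /dist_on (perm_big _ (perm_to_rem pP)) big_cons /=.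
by rewrite lerDl sumr_ge0.
Qed.

Lemma dist_on_triangle P u v w : dist_on P u w <= dist_on P u v + dist_on P v w.
Proof. by rewrite -big_split /=; apply: ler_sum => p _; exact: ler_distD. Qed.

Lemma dist_onC P u v : dist_on P u v = dist_on P v u.
Proof. by apply: eq_bigr => p _; rewrite distrC. Qed.

Lemma dist_on_lt P u v (e : R) : 0 < e ->
  (forall p, p \in P -> `|u p - v p| < e / (size P).+1%:R) -> dist_on P u v < e.
Proof.
move=> e0 h; have s0 : 0 < (size P).+1%:R :> R by rewrite ltr0n.
apply: (@le_lt_trans _ _ (\sum_(p <- P) e / (size P).+1%:R)).
  by rewrite /dist_on big_seq [leRHS]big_seq; apply: ler_sum => p /h /ltW.
rewrite big_const_seq count_predT iter_addr_0 -[_ *+ size P]mulr_natr -mulrA gtr_pMr //.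
by rewrite mulrC ltr_pdivrMr // mul1r ltr_nat.
Qed.

(** Rounding the values at the points of [P] sorts the functions into finitely many classes;
    one representative of each class makes a net. *)
Lemma finite_net (P : seq S) (e : R) : 0 < e -> exists (T : finType) (v : T -> S -> R),
  (forall t, K (v t)) /\ forall u, K u -> exists t, dist_on P u (v t) < e.
Proof.
move=> e0; pose e' := e / (size P).+1%:R.
have e'0 : 0 < e' by rewrite divr_gt0 // ltr0n.
pose m := (Num.trunc e'^-1).+1.
have m0 : 0 < m%:R :> R by rewrite ltr0n.
have me : m%:R^-1 < e'.
  by rewrite -[ltRHS]invrK ltf_pV2 ?posrE ?invr_gt0 // truncnS_gt.
pose T := {ffun 'I_(size P) -> 'I_m.+1}.
pose chi (u : S -> R) : T := [ffun j => inord (Num.trunc (m%:R * u (tnth (in_tuple P) j)))].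
have chiE u j : K u -> chi u j = Num.trunc (m%:R * u (tnth (in_tuple P) j)) :> nat.
  move=> /K01/(_ (tnth (in_tuple P) j)) /andP[u0 u1].
  rewrite ffunE inordK // ltnS -(ler_nat R) (@le_trans _ _ (m%:R * u (tnth (in_tuple P) j))) //.
    by rewrite truncn_le mulr_ge0.
  by rewrite ler_piMr.
have chi_close u v : K u -> K v -> chi u = chi v -> dist_on P u v < e.
  move=> Ku Kv uv; apply: dist_on_lt => // p /(tnthP (in_tuple P))[j ->].
  apply: le_lt_trans me; rewrite -(ler_pM2l m0) divff ?gt_eqF //.
  rewrite -[leLHS](ger0_norm (mulr_ge0 (ltW m0) (normr_ge0 _))) normrM normr_id -normrM mulrBr.
  have := congr1 (fun c : T => nat_of_ord (c j)) uv; rewrite /= !chiE //.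
  set a := m%:R * u _; set b := m%:R * v _ => ab.
  have a0 : 0 <= a by have /andP[? _] := K01 Ku (tnth (in_tuple P) j); rewrite mulr_ge0.
  have b0 : 0 <= b by have /andP[? _] := K01 Kv (tnth (in_tuple P) j); rewrite mulr_ge0.
  have /andP[] := truncn_itv a0; have /andP[] := truncn_itv b0; rewrite ab -!natr1.
  by rewrite ler_norml; lra.
have [u0 Ku0] := K0.
have /choice[v hv] : forall t : T, exists v, K v /\ forall u, K u -> chi u = t -> chi v = t.
  move=> t; have [[u [Ku ut]]|no] := pselect (exists u, K u /\ chi u = t).
    by exists u.
  by exists u0; split => // u Ku ut; case: no; exists u.
exists T, v; split=> [t|u Ku]; first by have [] := hv t.
by exists (chi u); have [Kv h] := hv (chi u); apply: chi_close => //; rewrite (h u).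
Qed.

(** Project [F u] onto the convex hull of a finite net with the weights [max (0, h - distance)] and apply the
    approximate fixed point theorem to the coefficients. *)
Lemma approx_fixed_point (P : seq S) (e : R) : 0 < e ->
  exists2 u, K u & forall p, p \in P -> `|F u p - u p| <= e.
Proof.
move=> e0; pose h := e / 2; have h0 : 0 < h by rewrite divr_gt0.
have [T [v [Kv net]]] := finite_net P (divr_gt0 h0 (ltr0n _ 2)).
have [u0 Ku0] := K0; have [t0 _] := net _ Ku0.
pose a (u : S -> R) t := Num.max 0 (h - dist_on P u (v t)).
pose W u := \sum_t a u t.
have a0 u t : 0 <= a u t by rewrite le_max lexx.
have aL u u' t : `|a u t - a u' t| <= dist_on P u u'.
  have := dist_on_triangle P u u' (v t); have := dist_on_triangle P u' u (v t).
  have : 0 <= dist_on P u u' by apply: sumr_ge0.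
  rewrite (dist_onC P u' u) /a ler_norml.
  by case: (leP 0 (h - dist_on P u _)); case: (leP 0 (h - dist_on P u' _)); lra.
have aW u t : a u t <= W u by rewrite /W (bigD1 t) //= lerDl sumr_ge0.
have Wh u : K u -> h / 2 <= W u.
  move=> Ku; have [t ut] := net _ Ku; apply: le_trans (aW _ t).
  by rewrite le_max; apply/orP; right; lra.
have WL u u' : `|W u - W u'| <= #|T|%:R * dist_on P u u'.
  rewrite /W -sumrB (le_trans (ler_norm_sum _ _ _)) //.
  by rewrite mulr_natl -sumr_const; apply: ler_sum.
pose U (x : T -> R) s := \sum_t x t * v t s.
have KU x : simplex x -> K (U x) by move=> xS; apply: Kconv.
pose g (x : T -> R) t := a (F (U x)) t / W (F (U x)).
have n0 : 0 < #|T|%:R :> R by rewrite ltr0n; apply/card_gt0P; exists t0.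
have sum_div_card (r : R) : \sum_(t : T) r / #|T|%:R = r.
  by rewrite sumr_const -[LHS]mulr_natr divfK // gt_eqF.
have h20 : 0 < h / 2 by rewrite divr_gt0.
have gS x : simplex x -> simplex (g x).
  move=> xS; have W0 : 0 < W (F (U x)) by apply: lt_le_trans (Wh _ (KF (KU _ xS))).
  by split=> [t|]; [rewrite divr_ge0 // ltW | rewrite -mulr_suml divff // gt_eqF].
have gc (e1 : R) : 0 < e1 -> exists2 d : R, 0 < d & forall x y, simplex x -> simplex y ->
     (forall t, `|x t - y t| < d) -> forall t, `|g x t - g y t| < e1.
  move=> e10; pose rho := e1 * (h / 2) / (1 + #|T|%:R).
  have rho0 : 0 < rho by rewrite divr_gt0 ?mulr_gt0 // ltr_wpDl.
  have [Q [d [d0 Qd]]] :=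
    pointwise_ucontinuous_seq P Fc (divr_gt0 rho0 (ltr0Sn R (size P))).
  exists (d / #|T|%:R); first by rewrite divr_gt0.
  move=> x y xS yS xy t.
  have KFx := KF (KU _ xS); have KFy := KF (KU _ yS).
  have D : dist_on P (F (U x)) (F (U y)) < rho.
    apply: dist_on_lt => //; apply: Qd; [exact: KU|exact: KU|move=> q _].
    rewrite /U -sumrB (le_lt_trans (ler_norm_sum _ _ _)) //.
    apply: (@lt_le_trans _ _ (\sum_(t : T) d / #|T|%:R)); last first.
      by rewrite sum_div_card.
    apply: ltr_sum => [|s _]; first by apply/hasP; exists t0; rewrite ?mem_index_enum.
    rewrite -mulrBl normrM (le_lt_trans _ (xy s)) // ler_piMr //.
    by have /andP[v0 v1] := K01 (Kv s) q; rewrite ger0_norm.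
  rewrite /g; set u := F (U x) in KFx D *; set u' := F (U y) in KFy D *.
  have Wu := Wh _ KFx; have Wu' := Wh _ KFy.
  have Wu0 : 0 < W u by apply: lt_le_trans Wu.
  have Wu'0 : 0 < W u' by apply: lt_le_trans Wu'.
  have -> : a u t / W u - a u' t / W u' =
      ((a u t - a u' t) + a u' t / W u' * (W u' - W u)) / W u.
    by field; rewrite !gt_eqF.
  rewrite normrM normfV (gtr0_norm Wu0) ltr_pdivrMr //.
  apply: (@lt_le_trans _ _ (e1 * (h / 2))); last by rewrite ler_wpM2l // ltW.
  apply: (@le_lt_trans _ _ ((1 + #|T|%:R) * dist_on P u u')); last first.
    by rewrite mulrC -ltr_pdivlMr // ltr_wpDl.
  rewrite mulrDl mul1r (le_trans (ler_normD _ _)) // lerD //.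
  rewrite normrM (le_trans _ (WL _ _)) // distrC ler_piMl //.
  by rewrite ger0_norm ?divr_ge0 // ?ler_pdivrMr ?mul1r // ltW.
have sim0 : exists x : T -> R, simplex x.
  exists (fun t => (t == t0)%:R); split => //.
  by rewrite (bigD1 t0) //= eqxx big1 ?addr0 // => t /negbTE->.
have [x xS hx] := approx_brouwer sim0 gS gc (divr_gt0 h0 n0).
exists (U x) => [|p pP]; first exact: KU.
have [g0 g1] := gS _ xS.
have -> : F (U x) p - U x p =
    \sum_t g x t * (F (U x) p - v t p) + \sum_t (g x t - x t) * v t p.
  rewrite -[X in X - _]mul1r -g1 mulr_suml -big_split /= /U -sumrB.
  by apply: eq_bigr => t _; ring.
have -> : e = h + h by rewrite /h; field.
rewrite (le_trans (ler_normD _ _)) // lerD //.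
  rewrite (le_trans (ler_norm_sum _ _ _)) //.
  apply: (@le_trans _ _ (\sum_t g x t * h)); last by rewrite -mulr_suml g1 mul1r.
  apply: ler_sum => t _; rewrite normrM (ger0_norm (g0 t)).
  have [d|d] := leP h (dist_on P (F (U x)) (v t)).
    by rewrite /g /a (max_l _) ?subr_le0 // !mul0r.
  by rewrite ler_wpM2l // (le_trans (le_dist_on _ _ pP)) // ltW.
rewrite (le_trans (ler_norm_sum _ _ _)) //.
apply: (@le_trans _ _ (\sum_(t : T) h / #|T|%:R)); last first.
  by rewrite sum_div_card.
apply: ler_sum => t _; rewrite normrM (le_trans _ (hx t)) // ler_piMr //.
by have /andP[v0 v1] := K01 (Kv t) p; rewrite ger0_norm.
Qed.

Hypothesis Kclosed : pointwise_closed K.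

(** A cluster point, in the compact cube, of approximate fixed points at more and more points. *)
Theorem cube_fixed_point : exists2 u, K u & forall s, F u s = u s.
Proof.
pose A (i : seq S * R) := [set u : {ptws S -> R} | K u /\ forall p, p \in i.1 -> `|F u p - u p| <= i.2].
pose D := [set i : seq S * R | 0 < i.2].
have PF : ProperFilter (filter_from D A).
  apply: filter_from_proper; last first.
    by move=> [P e] /= e0; have [u Ku hu] := approx_fixed_point P e0; exists u.
  apply: filter_from_filter; first by exists ([::], 1) => /=; rewrite /D /=.
  move=> [P e] [Q d] /= e0 d0; exists (P ++ Q, Num.min e d) => /=.
    by rewrite /D /= lt_min e0.
  move=> u [Ku hu]; split; split => // p pP.
    by have := hu p; rewrite /= mem_cat pP le_min => /(_ isT) /andP[].
  by have := hu p; rewrite /= mem_cat pP orbT le_min => /(_ isT) /andP[].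
have cK : compact [set u : {ptws S -> R} | forall s, `[0, 1]%classic (u s)].
  exact: (@tychonoff S (fun=> R) (fun=> `[0, 1]%classic) (fun=> @segment_compact R 0 1)).
have [u [_ clu]] : [set u : {ptws S -> R} | forall s, `[0, 1]%classic (u s)] `&`
    cluster (filter_from D A) !=set0.
  apply: cK; exists ([::], 1) => //; first by rewrite /D /=.
  by move=> u [Ku _] s /=; rewrite in_itv /=; apply: K01.
have near (P : seq S) (e : R) : 0 < e -> nbhs u [set v : {ptws S -> R} | forall p, p \in P -> `|u p - v p| < e].
  move=> e0; elim: P => [|p P IH].
    by apply: filterE => v p; rewrite in_nil.
  have := @proj_continuous S (fun=> R) p u (ball (u p) e) (nbhsx_ballx _ _ e0).
  move=> /(filterI IH); apply: filterS => v [h1 h2] q; rewrite in_cons.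
  by move=> /orP[/eqP->|/h1//]; exact: h2.
have approx (P : seq S) (e e' : R) : 0 < e -> 0 < e' -> exists v, [/\ K v, forall p, p \in P -> `|F v p - v p| <= e &
    forall p, p \in P -> `|u p - v p| < e'].
  move=> e0 e'0; have AF : filter_from D A (A (P, e)) by exists (P, e).
  by have [v [[Kv h1] h2]] := clu _ _ AF (near P _ e'0); exists v; split.
have Ku : K u.
  apply: Kclosed => P e e0; have [v [Kv _ hv]] := approx P e e e0 e0.
  by exists v.
exists u => // s; apply/eqP; rewrite -subr_eq0 -normr_le0.
apply/ler_addgt0Pr => e e0; rewrite add0r.
have e30 : 0 < e / 3 by rewrite divr_gt0.
have [Q [d [d0 Qd]]] := Fc s e30.
have m0 : 0 < Num.min d (e / 3) by rewrite lt_min d0.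
have [v [Kv h1 h2]] := approx (s :: Q) (e / 3) _ e30 m0.
have := h1 s (mem_head _ _).
have := h2 s (mem_head _ _); rewrite lt_min => /andP[_].
have : `|F u s - F v s| < e / 3.
  apply: Qd => // q qQ; have := h2 q; rewrite in_cons qQ orbT => /(_ isT).
  by rewrite lt_min => /andP[].
rewrite !ltr_norml !ler_norml; lra.
Qed.

End Schauder.

(** * Reflections of the line and completion of Lebesgue measure *)

Section Reflection.
Variable R : realType.
Notation mu := (@lebesgue_measure R).
Implicit Types (a : R) (f : R -> R).

Definition reflection a : measurableTypeR R -> measurableTypeR R := fun z => a - z.

Lemma measurable_reflection a : measurable_fun setT (reflection a).
Proof. exact: (@measurable_funB _ _ _ _ (cst a) id). Qed.

HB.instance Definition _ a :=
  isMeasurableFun.Build _ _ _ _ (reflection a) (measurable_reflection a).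

Lemma lebesgue_measure_reflection a (A : set R) :
  measurable A -> mu (reflection a @^-1` A) = mu A.
Proof.
move=> mA; apply/esym.
apply: (@lebesgue_measure_unique R (pushforward mu (reflection a))) => // X [[x y] _ <-] /=.
rewrite /pushforward (_ : _ @^-1` _ = `[a - y, a - x[%classic); last first.
  apply/seteqP; split => z /=; rewrite !in_itv /= /reflection => /andP[h1 h2];
  by apply/andP; split; lra.
rewrite !lebesgue_measure_itv /= !lte_fin ltrD2l ltrN2.
by case: ifP => // _; rewrite -!EFinB; congr EFin; ring.
Qed.

Lemma ge0_integral_reflection a f : measurable_fun setT f -> (forall x, 0 <= f x) ->
  (\int[mu]_z (f (a - z))%:E = \int[mu]_z (f z)%:E)%E.
Proof.
move=> mf f0; rewrite -[LHS](ge0_integral_pushforward (measurable_reflection a) mu (D := setT) (f := EFin \o f)) //.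
- by apply: eq_measure_integral => A mA _; exact: lebesgue_measure_reflection.
- exact/measurable_EFinP.
- by move=> x _ /=; rewrite lee_fin.
Qed.

Lemma integrable_reflection a f : mu.-integrable setT (EFin \o f) ->
  mu.-integrable setT (fun z => (f (a - z))%:E).
Proof.
move=> /integrableP[/measurable_EFinP mf fi]; apply/integrableP; split.
  apply/measurable_EFinP; apply: (measurableT_comp mf).
  exact: measurable_reflection.
rewrite [ltLHS](_ : _ = \int[mu]_z ((fun x => `|f x|) (a - z))%:E)%E //.
by rewrite (ge0_integral_reflection a (f := fun x => `|f x|)) //; exact: measurableT_comp.
Qed.

Lemma Rintegral_reflection a f : mu.-integrable setT (EFin \o f) ->
  \int[mu]_z f (a - z) = \int[mu]_z f z.
Proof.
move=> fi; have fr := integrable_reflection a fi; rewrite /Rintegral; congr fine.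
have /measurable_EFinP mf := measurable_int _ fi.
rewrite -[LHS](integral_pushforward (measurable_reflection a) (mu := mu) (D := setT) (f := EFin \o f)) //.
  by apply: eq_measure_integral => A mA _; exact: lebesgue_measure_reflection.
exact/measurable_EFinP.
Qed.

(** A translation is the composite of two reflections. *)
Lemma integrable_translation a f : mu.-integrable setT (EFin \o f) ->
  mu.-integrable setT (fun z => (f (z + a))%:E).
Proof.
move=> /(integrable_reflection a) /(integrable_reflection 0) /=.
by congr integrable; apply/funext => z; rewrite sub0r opprK addrC.
Qed.

Lemma Rintegral_translation a f : mu.-integrable setT (EFin \o f) ->
  \int[mu]_z f (z + a) = \int[mu]_z f z.
Proof.
move=> fi; rewrite -(Rintegral_reflection a fi).
rewrite -(Rintegral_reflection 0 (integrable_reflection a fi)) /=.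
by apply: eq_Rintegral => z _; rewrite sub0r opprK addrC.
Qed.

End Reflection.

Section Completion.
Variable R : realType.
Notation mu := (@lebesgue_measure R).

Lemma measurable_lebesgueType_id :
  measurable_fun [set: lebesgueType R] (id : lebesgueType R -> measurableTypeR R).
Proof.
move=> _ B mB; rewrite setTI preimage_id; exact: sub_caratheodory.
Qed.

(** A function equal to a Borel function off a Borel null set is measurable for the complete measure,
    and the Borel restriction of that measure, its image under the identity, is Lebesgue measure. *)
Lemma leb_ge0_integral (f g : R -> R) (N : set R) :
  measurable N -> mu N = 0%E -> (forall x, ~ N x -> f x = g x) ->
  measurable_fun setT g -> (forall x, 0 <= f x) -> (forall x, 0 <= g x) ->
  (\int[leb]_x (f x)%:E = \int[mu]_x (g x)%:E)%E.
Proof.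
move=> mN N0 fg mg f0 g0.
have mg' : measurable_fun [set: lebesgueType R] (EFin \o g : lebesgueType R -> \bar R).
  apply/measurable_EFinP.
  exact: (measurableT_comp (f := g : measurableTypeR R -> R) mg measurable_lebesgueType_id).
have fgae : ae_eq leb [set: lebesgueType R] (EFin \o g) (EFin \o f).
  exists N; split => //; first exact: sub_caratheodory.
  by move=> x /= h; apply: contrapT => Nx; apply: h => _; rewrite fg.
have mf' : measurable_fun [set: lebesgueType R] (EFin \o f : lebesgueType R -> \bar R).
  exact: (@ae_measurable_fun _ (lebesgueType R) R leb (@completed_lebesgue_measure_is_complete R) setT (EFin \o g) (EFin \o f) fgae mg').
transitivity (\int[leb]_x (g x)%:E)%E.
  apply: ge0_ae_eq_integral => //.
  - by move=> x _; rewrite lee_fin.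
  - by move=> x _; rewrite lee_fin.
  - exact: ae_eq_sym.
rewrite -[LHS](ge0_integral_pushforward measurable_lebesgueType_id leb (D := setT) (f := EFin \o g)) //.
- exact/measurable_EFinP.
- by move=> x _ /=; rewrite lee_fin.
Qed.

(** Each set [k < q] with [q] rational is Borel up to a null set; [N] is the union of these countably
    many null sets, and killing [k] on any larger Borel set leaves only Borel level sets. *)
Lemma borel_version (k : R -> R) :
  measurable_fun [set: lebesgueType R] (k : lebesgueType R -> R) ->
  exists N : set R, [/\ measurable N, mu N = 0%E &
    forall M : set R, measurable M -> N `<=` M -> measurable_fun setT (k \* \1_(~` M))].
Proof.
move=> mk.
pose q n : R := ratr (odflt 0 (choice.unpickle n) : rat).
have /choice[A hA] : forall n, exists AN : set R * set R,
    [/\ measurable AN.1, measurable AN.2, mu AN.2 = 0%E &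
     forall x, ~ AN.2 x -> (AN.1 x <-> k x < q n)].
  move=> n.
  have : ((@wlength R idfun)^*)%mu.-cara.-measurable (k @^-1` `]-oo, q n[).
    by rewrite -[X in _ X]setTI; apply: mk => //; exact: measurable_itv.
  rewrite -completed_caratheodory_measurable g_sigma_completed_algebra_genE.
  move=> [X mX [N [N' [mN' N'0 NN'] XN]]].
  exists (X, N'); split => //= x N'x.
  have : (X `|` N) x <-> k x < q n by rewrite XN /= in_itv.
  by move=> <-; split; [left | case=> // /NN'].
pose N := \bigcup_n (A n).2.
have mN : measurable N by apply: bigcupT_measurable => n; have [] := hA n.
exists N; split => //.
  apply/negligibleP => //.
  apply: negligible_bigcup => n; have [_ m2 m3 _] := hA n. by exists (A n).2; split.
move=> M mM NM; apply: (measurability _ (RGenInftyO.measurableE R)) => //.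
move=> _ [_ [r ->] <-]; rewrite setTI.
have -> : (k \* \1_(~` M)) @^-1` `]-oo, r[ =
    (if 0 < r then M else set0) `|` \bigcup_(n in [set n | q n < r]) ((A n).1 `\` M).
  apply/seteqP; split => x /=; rewrite in_itv /= indicE.
    have [Mx|Mx] := pselect (M x).
      by rewrite memNset ?mulr0 => [-> |]; [left | move=> /(_ Mx)].
    rewrite mem_set // mulr1 => kr; right.
    have [p kp pr] : exists2 p : rat, k x < ratr p & ratr p < r.
      by have [p] := rat_in_itvoo kr; rewrite in_itv /= => /andP[]; exists p.
    exists (choice.pickle p) => /=; first by rewrite /q choice.pickleK.
    split => //; have [_ _ _ h] := hA (choice.pickle p).
    by apply/h; [move=> Nx; apply: Mx; apply: NM; exists (choice.pickle p) | rewrite /q choice.pickleK].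
  case; first by case: ifP => // r0 Mx; rewrite memNset ?mulr0 // => /(_ Mx).
  move=> [n /= qr [Ax Mx]]; rewrite mem_set // mulr1; apply: lt_trans qr.
  have [_ _ _ h] := hA n; apply/h => // Nx; apply: Mx; apply: NM; by exists n.
apply: measurableU; first by case: ifP.
by apply: bigcup_measurable => n _; apply: measurableD => //; have [] := hA n.
Qed.

End Completion.

(** * Even kernels with exponential moments *)

Section Kernel.
Variable R : realType.
Notation mu := (@lebesgue_measure R).

Definition borel_kernel (k : R -> R) : Prop :=
  [/\ measurable_fun setT k, forall x, 0 <= k x, forall x, k (- x) = k x,
      (\int[mu]_x (k x)%:E = 1)%E &
      forall a, mu.-integrable setT (fun x => (expR (a * x) * k x)%:E)].

Lemma measurable_expR_affine (a b : R) : measurable_fun setT (fun x : R => expR (a * x - b)).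
Proof.
by apply: (measurableT_comp (@measurable_expR R)); apply: measurable_funB.
Qed.

Lemma measurable_expRM (a : R) : measurable_fun setT (fun x : R => expR (a * x)).
Proof.
by have := measurable_expR_affine a 0; under eq_fun do rewrite subr0.
Qed.

(** The exceptional null set is made symmetric so that the Borel version stays even. *)
Lemma borel_kernel_version (k : R -> R) : dispersal_kernel k ->
  exists2 k', borel_kernel k' &
    forall g : R -> R, measurable_fun setT g -> (forall x, 0 <= g x) ->
    (\int[leb]_y (g y * k y) = \int[mu]_y (g y * k' y)) /\
    (forall a, \int[leb]_y (g y * k (a - y)) = \int[mu]_z (g (a - z) * k' z)).
Proof.
move=> [k0 [mk ik] ke k1 kexp].
have [N [mN N0 Nk]] := borel_version mk.
pose M := N `|` reflection 0 @^-1` N.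
have mrefl a (A : set R) : measurable A -> measurable (reflection a @^-1` A).
  by move=> mA; rewrite -[X in measurable X]setTI; apply: measurable_reflection.
have mM : measurable M by apply: measurableU => //; exact: mrefl.
have M0 : mu M = 0%E.
  have mN0 : measurable (reflection 0 @^-1` N) by exact: mrefl.
  have N00 : mu (reflection 0 @^-1` N) = 0%E by rewrite lebesgue_measure_reflection.
  exact: null_set_setU.
have MN x : M x -> M (- x).
  by case=> h; [right; rewrite /= /reflection sub0r opprK | left; move: h; rewrite /= /reflection sub0r].
pose k' := k \* \1_(~` M).
have mk' : measurable_fun setT k' by apply: Nk => //; exact: subsetUl.
have k'E x : ~ M x -> k x = k' x.
  by move=> Mx; rewrite /k' /= indicE mem_set ?mulr1.
have k'0 x : 0 <= k' x by rewrite mulr_ge0.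
have k'e x : k' (- x) = k' x.
  rewrite /k' /= !indicE -ke; congr (_ * (_ : bool)%:R).
  apply/idP/idP; rewrite !inE /= => h Mx; apply: h; first exact: MN.
  by rewrite -[x]opprK; exact: MN.
have lebE (g : R -> R) : measurable_fun setT g -> (forall x, 0 <= g x) ->
    (\int[leb]_y (g y * k y)%:E = \int[mu]_y (g y * k' y)%:E)%E.
  move=> mg g0; apply: (leb_ge0_integral mM M0).
  - by move=> x Mx; rewrite k'E.
  - exact: measurable_funM.
  - by move=> x; rewrite mulr_ge0.
  - by move=> x; rewrite mulr_ge0.
exists k'.
  have i1 : (\int[mu]_x (k' x)%:E = 1)%E.
    transitivity (\int[mu]_x (1 * k' x)%:E)%E.
      by apply: eq_integral => x _; rewrite mul1r.
    rewrite -(lebE (cst 1)) //.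
    transitivity (\int[leb]_x (k x)%:E)%E.
      by apply: eq_integral => x _; rewrite mul1r.
    rewrite -k1 fineK //; exact: integrable_fin_num.
  split => //.
  suff pos a : 0 <= a -> mu.-integrable setT (fun x => (expR (a * x) * k' x)%:E).
    move=> a; have [/pos//|a0] := leP 0 a.
    have /pos/(integrable_reflection 0) : 0 <= - a by rewrite oppr_ge0 ltW.
    by congr integrable; apply/funext => x; rewrite sub0r mulrNN k'e.
  move=> a0; apply/integrableP; split.
    apply/measurable_EFinP; apply: measurable_funM => //; exact: measurable_expRM.
  apply: le_lt_trans (kexp a a0).
  rewrite le_eqVlt; apply/orP; left; apply/eqP.
  transitivity (\int[leb]_y (expR (a * y) * k y)%:E)%E.
    rewrite (lebE _ (measurable_expRM a)) => [|x]; last exact: expR_ge0.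
    by apply: eq_integral => x _ /=; rewrite ger0_norm // mulr_ge0 ?expR_ge0.
  by apply: eq_integral => x _; rewrite mulrC.
move=> g mg g0; split; first by rewrite /Rintegral lebE.
move=> a; rewrite /Rintegral; congr fine.
have h0 z : 0 <= g (a - z) * k' z by rewrite mulr_ge0.
have mh : measurable_fun setT (fun z : R => g (a - z) * k' z).
  by apply: measurable_funM => //; apply: (measurableT_comp mg); exact: measurable_reflection.
rewrite -(ge0_integral_reflection a mh h0).
apply: (@leb_ge0_integral _ _ _ (reflection a @^-1` M)).
- exact: mrefl.
- by rewrite lebesgue_measure_reflection.
- by move=> x Mx; rewrite subKr k'E.
- by apply: (measurableT_comp mh); exact: measurable_reflection.
- by move=> x; rewrite mulr_ge0.
- by [].
Qed.

End Kernel.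

(** * Continuity of translation in L1 *)

Section RealIntegrable.
Context {R : realType}.
Notation mu := (@lebesgue_measure R).
Implicit Types f g : R -> R.

Definition L1 f := mu.-integrable [set: R] (EFin \o f).

Lemma L1_measurable f : L1 f -> measurable_fun setT f.
Proof. by move=> fi; apply/measurable_EFinP; exact: measurable_int fi. Qed.

Lemma L1D f g : L1 f -> L1 g -> L1 (fun x => f x + g x).
Proof. by move=> fi gi; have := integrableD measurableT fi gi. Qed.

Lemma L1B f g : L1 f -> L1 g -> L1 (fun x => f x - g x).
Proof. by move=> fi gi; have := integrableB measurableT fi gi. Qed.

Lemma L1Z (r : R) f : L1 f -> L1 (fun x => r * f x).
Proof. by move=> fi; have := integrableZl measurableT r fi. Qed.

Lemma L1_norm f : L1 f -> L1 (fun x => `|f x|).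
Proof. exact: integrable_norm. Qed.

Lemma L1_le f g : measurable_fun setT f -> (forall x, `|f x| <= g x) -> L1 g -> L1 f.
Proof.
move=> mf fg gi; apply: (le_integrable measurableT _ _ gi); first exact/measurable_EFinP.
by move=> x _ /=; rewrite lee_fin (le_trans (fg x)) // ler_norm.
Qed.

Lemma L1_cvg0 (f : nat -> R -> R) g : (forall n, measurable_fun setT (f n)) -> L1 g ->
  (forall n x, `|f n x| <= g x) -> (forall x, f n x @[n --> \oo] --> 0) ->
  \int[mu]_x f n x @[n --> \oo] --> 0.
Proof.
move=> mf gi fg f0.
have h : (\int[mu]_x (f n x)%:E)%E @[n --> \oo] --> (\int[mu]_x 0%:E)%E.
  apply: (@dominated_cvg _ _ _ mu setT measurableT (fun n => EFin \o f n) (fun=> 0%E) (EFin \o g)) => //.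
  - by move=> n; apply/measurable_EFinP; exact: mf.
  - move=> x _; apply: cvg_EFin; [exact: nearW | exact: f0].
  - by move=> n x _ /=; rewrite lee_fin.
rewrite integral0 in h.
exact: (fine_cvg h).
Qed.

End RealIntegrable.

Section Translation.
Context {R : realType}.
Notation mu := (@lebesgue_measure R).
Implicit Types f g : R -> R.

Definition cutoff (n : nat) (z : R) : R := Num.max 0 (Num.min 1 (n%:R + 1 - `|z|)).

Lemma cutoff_itv n z : 0 <= cutoff n z <= 1.
Proof.
by rewrite /cutoff le_max lexx ge_max ler01 ge_min lexx.
Qed.

Lemma cutoff_eq1 n z : `|z| <= n%:R -> cutoff n z = 1.
Proof.
move=> zn; rewrite /cutoff min_l; first by rewrite max_r.
by move: zn; lra.
Qed.

Lemma cutoff_eq0 n z : n%:R + 1 <= `|z| -> cutoff n z = 0.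
Proof.
by move=> zn; rewrite /cutoff max_l // ge_min subr_le0 zn orbT.
Qed.

Lemma continuous_cutoff n : continuous (cutoff n).
Proof.
move=> z; apply: (@continuous_max R R (cst 0) (fun z => Num.min 1 (n%:R + 1 - `|z|))).
  exact: cvg_cst.
apply: (@continuous_min R R (cst 1) (fun z => n%:R + 1 - `|z|)).
  exact: cvg_cst.
by apply: continuousB; [exact: cst_continuous | exact: norm_continuous].
Qed.

(** Cut [f] off by dominated convergence, approximate it by a continuous function on a compact
    interval, and cut the approximation off in the same continuous way. *)
Lemma L1_dense_continuous f (e : R) : L1 f -> 0 < e ->
  exists (p : R -> R) (A : R), [/\ continuous p, forall z, A <= `|z| -> p z = 0, L1 p &
    \int[mu]_z `|f z - p z| < e].
Proof.
move=> fi e0; have mf := L1_measurable fi.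
have mcut n : measurable_fun setT (cutoff n).
  by apply: continuous_measurable_fun; exact: continuous_cutoff.
have cut0 n z : 0 <= cutoff n z by case/andP: (cutoff_itv n z).
have cut1 n z : cutoff n z <= 1 by case/andP: (cutoff_itv n z).
pose fn (n : nat) (z : R) : R := `|f z - f z * cutoff n z|.
have mfn n : measurable_fun setT (fn n).
  by apply: measurableT_comp => //; apply: measurable_funB => //; apply: measurable_funM.
have fn_le n z : `|fn n z| <= `|f z|.
  rewrite /fn normr_id -{1}[f z]mulr1 -mulrBr normrM ler_piMr //.
  by rewrite ger0_norm ?subr_ge0 // gerBl.
have h : \int[mu]_z fn n z @[n --> \oo] --> 0.
  apply: (L1_cvg0 mfn (L1_norm fi)) => // z.
  apply: cvg_near_cst; exists (Num.trunc `|z|).+1 => // n /= zn.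
  rewrite /fn cutoff_eq1 ?mulr1 ?subrr ?normr0 //.
  by rewrite (le_trans (ltW (truncnS_gt _))) // ler_nat.
have e20 : 0 < e / 2 by rewrite divr_gt0.
have /cvgr0Pnorm_lt/(_ _ e20)[N _ hN] := h.
have {hN} hN : \int[mu]_z fn N z < e / 2.
  by apply: le_lt_trans (hN N (leqnn _)); exact: ler_norm.
pose A : R := N%:R + 1.
pose E : set R := `[- A, A]%classic.
have mE : measurable (E : set (measurableTypeR R)) by exact: measurable_itv.
have Efin : (mu E < +oo)%E.
  by rewrite /E /= lebesgue_measure_itv /=; case: ifP => // _; rewrite -EFinB ltry.
have fiE : mu.-integrable E (EFin \o f) by apply: integrableS fi.
have [g [cg gi gf]] := approximation_continuous_integrable mE Efin fiE.
have [n hn] : exists n, (\int[mu]_(z in E) `|(f z - g n z)%:E| < (e / 2)%:E)%E.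
  have /fine_fcvg/cvgr0Pnorm_lt/(_ _ e20)[n _ hn] := gf.
  exists n; have := hn n (leqnn _).
  have fin : (\int[mu]_(z in E) `|(f z - g n z)%:E|)%E \is a fin_num.
    apply: integrable_fin_num => //; apply: integrable_abse => //.
    by have := integrableB mE fiE (gi n).
  by move=> /= h1; rewrite -(fineK fin) lte_fin; apply: le_lt_trans h1; exact: ler_norm.
pose p z := g n z * cutoff N z.
have cp : continuous p.
  by move=> z; apply: cvgM; [exact: cg | exact: continuous_cutoff].
have mp : measurable_fun setT p by exact: continuous_measurable_fun.
have p0 z : A <= `|z| -> p z = 0 by move=> Az; rewrite /p cutoff_eq0 ?mulr0.
have [M hM] : exists M : R, forall z, `|p z| <= M * \1_E z.
  have : bounded_set (p @` E).
    apply: compact_bounded; apply: continuous_compact; last exact: segment_compact.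
    exact: continuous_subspaceT.
  move=> [M [_ hM]]; exists (M + 1) => z.
  have [Ez|nEz] := pselect (E z).
    rewrite indicE mem_set // mulr1; apply: (hM (M + 1)); first by rewrite ltrDl.
    by exists z.
  rewrite indicE memNset // mulr0 p0 ?normr0 // leNgt; apply/negP => /ltW.
  by rewrite ler_norml => h1; apply: nEz; rewrite /E /= in_itv.
have pi : L1 p.
  by apply: (L1_le mp hM); apply: L1Z; exact: integrable_indic_itv.
exists p, A; split => //.
have -> : e = e / 2 + e / 2 by field.
pose q z := `|f z * cutoff N z - p z|.
have i1 : L1 (fn N) by apply: (L1_le (mfn N) (fn_le N)); exact: L1_norm.
have fci : L1 (fun z => f z * cutoff N z).
  apply: (L1_le _ _ (L1_norm fi)); first by apply: measurable_funM.
  by move=> z; rewrite normrM ler_piMr // ger0_norm.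
have i2 : L1 q by apply: L1_norm; exact: L1B.
apply: (@le_lt_trans _ _ (\int[mu]_z (fn N z + q z))).
  apply: le_Rintegral => //; [by apply: L1_norm; exact: L1B | exact: L1D |].
  by move=> z _; exact: ler_distD.
rewrite RintegralD //; apply: ltrD => //.
rewrite -lte_fin; apply: le_lt_trans hn.
rewrite /Rintegral fineK; last exact: integrable_fin_num.
rewrite [leRHS]integral_mkcond; apply: ge0_le_integral => //.
- by move=> z _; rewrite lee_fin normr_ge0.
- by apply/measurable_EFinP; exact: L1_measurable.
- apply/(measurable_restrictT _ mE).
  apply: measurableT_comp => //; apply/measurable_EFinP; apply: measurable_funB.
    exact: measurable_funTS.
  by apply: measurable_funTS; exact: continuous_measurable_fun.
- move=> z _; rewrite patchE; case: ifPn => [_|]; rewrite lee_fin /q /p.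
    by rewrite -mulrBl normrM ler_piMr // ger0_norm.
  rewrite notin_setE => nEz; rewrite cutoff_eq0 ?mulr0 ?subrr ?normr0 //.
  rewrite -/A leNgt; apply/negP => /ltW.
  by rewrite ler_norml => h1; apply: nEz; rewrite /E /= in_itv.
Qed.

Lemma L1_translate f h : L1 f -> L1 (fun z => f (z + h)).
Proof. exact: integrable_translation. Qed.

(** The integrand is continuous in [h] and, for [|h| < 1], bounded by a constant on a fixed interval
    outside of which it vanishes. *)
Lemma L1_translation_compact (p : R -> R) (A e : R) : continuous p ->
  (forall z, A <= `|z| -> p z = 0) -> 0 < e -> exists2 d : R, 0 < d &
  forall h, `|h| < d -> \int[mu]_z `|p (z + h) - p z| < e.
Proof.
move=> cp p0 e0.
have mp : measurable_fun setT p by exact: continuous_measurable_fun.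
pose B := `|A| + 1.
have [M M0 hM] : exists2 M : R, 0 <= M & forall z, `|p z| <= M.
  have : bounded_set (p @` `[- B, B]%classic).
    apply: compact_bounded; apply: continuous_compact; last exact: segment_compact.
    exact: continuous_subspaceT.
  move=> [M [_ hM]]; exists (`|M| + 1) => [|z]; first by rewrite addr_ge0.
  have [Bz|zB] := leP `|z| B; last first.
    rewrite p0 ?normr0 ?addr_ge0 // ltW // (le_lt_trans (ler_norm A)) //.
    by apply: lt_trans zB; rewrite ltrDl.
  apply: (hM (`|M| + 1)); first by rewrite ltr_pwDr // ler_norm.
  by exists z => //=; rewrite in_itv /= -ler_norml.
pose C := B + 1.
pose g z : R := (M + M) * \1_(`[- C, C]%classic : set R) z.
have gi : L1 g by apply: L1Z; exact: integrable_indic_itv.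
pose F (h z : R) : R := `|p (z + h) - p z|.
have mF h : measurable_fun setT (F h).
  apply: measurableT_comp => //; apply: measurable_funB => //.
  by apply: (measurableT_comp mp); exact: measurable_funD.
have Fg h z : `]-1, 1[%classic h -> `|F h z| <= g z.
  rewrite /= in_itv /= => h1; rewrite /F normr_id /g.
  have [Cz|zC] := leP `|z| C.
    rewrite indicE mem_set ?mulr1; last by rewrite /= in_itv /= -ler_norml.
    by rewrite (le_trans (ler_normB _ _)) // lerD.
  have hn : `|h| < 1 by rewrite ltr_norml.
  have A1 := ler_norm A.
  have : `|z| - `|h| <= `|z + h| by rewrite -[`|h|]normrN; have := lerB_dist z (- h); rewrite opprK.
  move: zC; rewrite /C /B => zC zh.
  rewrite !p0 ?subrr ?normr0 ?mulr_ge0 ?addr_ge0 //; lra.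
have /= c0 := @continuity_under_integral R _ _ mu F setT measurableT (-1) 1
   (fun h hI => L1_le (mF h) (fun z => Fg h z hI) gi) _ g gi _ 0 _.
have : \int[mu]_z F h z @[h --> (0 : R)] --> \int[mu]_z F 0 z.
  apply: c0; last by rewrite inE /= in_itv /= ltr01 ltrN10.
    apply/aeW => z _ h _; apply: cvg_norm; apply: cvgB; last exact: cvg_cst.
    apply: (@continuous_comp _ _ _ (fun h => z + h) p); last exact: cp.
    by apply: cvgD; [exact: cvg_cst | exact: cvg_id].
  by move=> h hI; apply/aeW => z _; exact: Fg.
have -> : \int[mu]_z F 0 z = 0.
  rewrite (_ : F 0 = cst 0) ?Rintegral_cst ?mul0r //.
  by apply/funext => z; rewrite /F addr0 subrr normr0.
move=> /cvgr0Pnorm_lt/(_ _ e0)/nbhs_ballP[d /= d0 hd].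
exists d => // h hd'; have := hd h; rewrite /ball /= sub0r normrN => /(_ hd').
by apply: le_lt_trans; exact: ler_norm.
Qed.

(** Translation is an isometry of [L1], so it is enough to know the result on a dense subset. *)
Lemma L1_translation_continuous f (e : R) : L1 f -> 0 < e ->
  exists2 d : R, 0 < d & forall h, `|h| < d -> \int[mu]_z `|f (z + h) - f z| < e.
Proof.
move=> fi e0; have e30 : 0 < e / 3 by rewrite divr_gt0.
have [p [A [cp p0 pi fp]]] := L1_dense_continuous fi e30.
have [d d0 hd] := L1_translation_compact cp p0 e30.
exists d => // h /hd ph.
pose r z := `|f z - p z|.
have ri : L1 r by apply: L1_norm; exact: L1B.
have rhi := L1_translate h ri.
have qi : L1 (fun z => `|p (z + h) - p z|).
  by apply/L1_norm/L1B => //; exact: L1_translate.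
have i1 : L1 (fun z => r (z + h) + `|p (z + h) - p z|) by exact: L1D.
apply: (@le_lt_trans _ _ (\int[mu]_z (r (z + h) + `|p (z + h) - p z| + r z))).
  apply: le_Rintegral => //; [|exact: L1D|].
    by apply/L1_norm/L1B => //; exact: L1_translate.
  move=> z _; rewrite /r [`|f z - _|]distrC.
  have -> : f (z + h) - f z = (f (z + h) - p (z + h)) + (p (z + h) - p z) + (p z - f z) by ring.
  by rewrite (le_trans (ler_normD _ _)) // lerD // ler_normD.
rewrite RintegralD // RintegralD // Rintegral_translation //.
have -> : e = e / 3 + e / 3 + e / 3 by field.
by apply: ltrD => //; apply: ltrD.
Qed.

End Translation.

(** * Averages against a kernel *)

Section Average.
Context {R : realType}.
Notation mu := (@lebesgue_measure R).
Variables (k : R -> R) (bk : borel_kernel k).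
Implicit Types (g h : R -> R).

Definition avg (k : R -> R) h := \int[mu]_z (h z * k z).

Definition avgable (k : R -> R) h := L1 (fun z => h z * k z).

Lemma kernel_ge0 z : 0 <= k z. Proof. by have [_ h _ _ _] := bk. Qed.

Lemma kernel_even z : k (- z) = k z. Proof. by have [_ _ h _ _] := bk. Qed.

Lemma kernel_L1 : L1 k.
Proof.
have [_ _ _ _ /(_ 0)] := bk.
by congr integrable; apply/funext => z /=; rewrite mul0r expR0 mul1r.
Qed.

Lemma avgable_bounded (M : R) h : measurable_fun setT h -> (forall z, `|h z| <= M) ->
  avgable k h.
Proof.
move=> mh hM; apply: (L1_le _ _ (L1Z M kernel_L1)).
  by apply: measurable_funM => //; exact: L1_measurable kernel_L1.
by move=> z; rewrite normrM (ger0_norm (kernel_ge0 z)) ler_wpM2r ?kernel_ge0.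
Qed.

Lemma avgable_exp a : avgable k (fun z => expR (a * z)).
Proof. by have [_ _ _ _ h] := bk; exact: h. Qed.

Lemma avgable_cst r : avgable k (cst r).
Proof. by apply: (@avgable_bounded `|r|) => //; exact: measurable_cst. Qed.

Lemma avgableD g h : avgable k g -> avgable k h -> avgable k (fun z => g z + h z).
Proof.
move=> gi hi; have := L1D gi hi.
by congr integrable; apply/funext => z /=; rewrite mulrDl.
Qed.

Lemma avgableZ r h : avgable k h -> avgable k (fun z => r * h z).
Proof.
move=> hi; have := L1Z r hi.
by congr integrable; apply/funext => z /=; rewrite mulrA.
Qed.

Lemma avgD g h : avgable k g -> avgable k h ->
  avg k (fun z => g z + h z) = avg k g + avg k h.
Proof.
move=> gi hi; rewrite /avg -RintegralD //.
by apply: eq_Rintegral => z _; rewrite mulrDl.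
Qed.

Lemma avgZ r h : avgable k h -> avg k (fun z => r * h z) = r * avg k h.
Proof.
move=> hi; rewrite /avg -RintegralZl //.
by apply: eq_Rintegral => z _; rewrite mulrA.
Qed.

Lemma avg_cst r : avg k (cst r) = r.
Proof.
have [_ _ _ k1 _] := bk.
rewrite /avg RintegralZl //; last exact: kernel_L1.
by rewrite /Rintegral k1 /= mulr1.
Qed.

Lemma le_avg g h : avgable k g -> avgable k h -> (forall z, g z <= h z) ->
  avg k g <= avg k h.
Proof.
by move=> gi hi gh; apply: le_Rintegral => // z _; rewrite ler_wpM2r ?kernel_ge0.
Qed.

Lemma avg_reflect h : avgable k h -> avg k (fun z => h (- z)) = avg k h.
Proof.
move=> hi; rewrite /avg -[RHS](Rintegral_reflection 0) //.
by apply: eq_Rintegral => z _; rewrite sub0r kernel_even.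
Qed.

Lemma avgable_reflect h : avgable k h -> avgable k (fun z => h (- z)).
Proof.
move=> /(integrable_reflection 0).
by congr integrable; apply/funext => z /=; rewrite sub0r kernel_even.
Qed.

Definition mgf (k : R -> R) a := avg k (fun z => expR (a * z)).

Lemma mgfN a : mgf k (- a) = mgf k a.
Proof.
rewrite /mgf -[RHS]avg_reflect; last exact: avgable_exp.
by congr avg; apply/funext => z; rewrite mulNr mulrN.
Qed.

Lemma avgable_exp_conv a x : avgable k (fun z => expR (a * (x - z))).
Proof.
have := avgableZ (expR (a * x)) (avgable_exp (- a)).
by congr avgable; apply/funext => z /=; rewrite -expRD mulNr mulrBr.
Qed.

Lemma avg_exp_conv a x : avg k (fun z => expR (a * (x - z))) = expR (a * x) * mgf k a.
Proof.
rewrite -mgfN -avgZ; last exact: avgable_exp.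
by congr avg; apply/funext => z /=; rewrite -expRD mulNr mulrBr.
Qed.

(** By symmetry the average of an exponential is that of a hyperbolic cosine. *)
Lemma mgf_ge1 a : 1 <= mgf k a.
Proof.
have h : 2 <= mgf k a + mgf k (- a).
  rewrite /mgf -avgD; [|exact: avgable_exp..].
  rewrite -[leLHS]avg_cst; apply: le_avg => [||z].
  - exact: avgable_cst.
  - by apply: avgableD; exact: avgable_exp.
  - rewrite mulNr; have := expR_ge1Dx (a * z); have := expR_ge1Dx (- (a * z)).
    by rewrite /cst; lra.
by move: h; rewrite mgfN; lra.
Qed.

(** By symmetry [h] may be replaced by [h z + h (- z)], which is positive everywhere. *)
Lemma avg_gt0 h : avgable k h -> (forall z, 0 <= h z) -> (forall z, 0 <= z -> 0 < h z) ->
  0 < avg k h.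
Proof.
move=> hi h0 hp; pose g z := h z + h (- z).
have gi : avgable k g by apply: avgableD => //; exact: avgable_reflect.
have g0 z : 0 < g z.
  have [z0|z0] := leP 0 z; first by rewrite ltr_wpDr ?hp.
  by rewrite ltr_wpDl // hp // oppr_ge0 ltW.
have gE : avg k g = 2 * avg k h.
  by rewrite avgD ?avg_reflect //; [ring | exact: avgable_reflect].
have ge0 : 0 <= avg k h by apply: Rintegral_ge0 => z _; rewrite mulr_ge0 ?kernel_ge0.
rewrite lt_neqAle ge0 andbT; apply/eqP => e.
have : (\int[mu]_z `|(g z * k z)%:E| = 0)%E.
  rewrite -[LHS]fineK; last exact/integrable_fin_num/integrable_abse.
  congr EFin; transitivity (avg k g); last by rewrite gE -e mulr0.
  by apply: eq_Rintegral => z _ /=; rewrite ger0_norm // mulr_ge0 ?kernel_ge0 // ltW.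
move=> /ae_eq_integral_abs -/(_ measurableT (measurable_int _ gi)) gk0.
have : avg k (cst 1) = 0.
  rewrite /avg /Rintegral (@ae_eq_integral _ _ _ mu setT (cst 0%E)) //.
  - by rewrite integral0.
  - by apply/measurable_EFinP; exact: L1_measurable (avgable_cst 1).
  apply: filterS gk0 => z /= /(_ Logic.I) h1 _; move: h1 => [] /eqP.
  by rewrite mulf_eq0 gt_eqF //= => /eqP->; rewrite mulr0.
by rewrite avg_cst => /eqP; rewrite oner_eq0.
Qed.

(** For [|b| <= B] the function [exp (b z)] is dominated by [exp (B z) + exp (- B z)]. *)
Lemma continuous_mgf : continuous (mgf k).
Proof.
move=> a; pose B := `|a| + 1.
pose g z : R := expR (B * z) * k z + expR (- B * z) * k z.
have gi : L1 g by apply: L1D; [exact: (avgable_exp B) | exact: (avgable_exp (- B))].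
have ub b z : `]- B, B[%classic b -> `|expR (b * z) * k z| <= g z.
  rewrite /= in_itv /= => /andP[b1 b2].
  rewrite /g -mulrDl normrM (ger0_norm (kernel_ge0 z)) (ger0_norm (expR_ge0 _)).
  rewrite ler_wpM2r ?kernel_ge0 //.
  have [z0|z0] := leP 0 z.
    by rewrite ler_wpDr ?expR_ge0 // ler_expR ler_wpM2r // ltW.
  by rewrite ler_wpDl ?expR_ge0 // ler_expR ler_wnM2r // ltW.
apply: (@continuity_under_integral R _ _ mu (fun b z => expR (b * z) * k z) setT measurableT
   (- B) B (fun b _ => avgable_exp b) _ g gi _ a _).
- apply/aeW => z _ b _; apply: cvgM; last exact: cvg_cst.
  apply: continuous_comp; last exact: continuous_expR.
  by apply: cvgM; [exact: cvg_id | exact: cvg_cst].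
- by move=> b bB; apply/aeW => z _; exact: ub.
- by rewrite inE /= in_itv /= -ltr_norml /B ltrDl.
Qed.

End Average.

(** * The dispersion relation *)

(** The value 1 is taken by the intermediate value theorem.  Convexity between any [lam] and [l0], where
    the function is below 1, gives the rest: if the function were at most 1 before the crossing it would
    be below 1 at the crossing, and after the crossing it lies below 1. *)
Lemma convex_unit_crossing {R : realType} (L : R -> R) (l0 : R) :
  (forall t x y, 0 <= t -> t <= 1 -> L (t * x + (1 - t) * y) <= t * L x + (1 - t) * L y) ->
  continuous L -> 1 < L 0 -> 0 < l0 -> L l0 < 1 ->
  exists l, [/\ 0 < l, L l = 1, forall lam, 0 < lam < l -> 1 < L lam &
      exists2 eta : R, 1 < eta < 2 & forall lam, l < lam < eta * l -> L lam < 1].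
Proof.
move=> cvxL cL L1 l00 L0.
have [l] : exists2 l, l \in `[0, l0] & L l = 1.
  apply: IVT; first exact: ltW.
    by apply: continuous_subspaceT.
  by rewrite ge_min le_max (ltW L0) (ltW L1) orbT.
rewrite in_itv /= => /andP[l_ge0 l_le] Ll.
have lgt0 : 0 < l by rewrite lt_neqAle l_ge0 andbT; apply: contraTneq L1 => ->; rewrite Ll ltxx.
have llt : l < l0.
  by rewrite lt_neqAle l_le andbT; apply: contraTneq L0 => <-; rewrite Ll ltxx.
have conv (x y z : R) : x < y -> y < z -> exists t : R, [/\ 0 < t, t < 1 & L y <= t * L x + (1 - t) * L z].
  move=> xy yz; have zx : 0 < z - x by lra.
  have zy : 0 < z - y by lra.
  exists ((z - y) / (z - x)); rewrite divr_gt0 // ltr_pdivrMr // mul1r; split => //; first lra.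
  have {1}-> : y = ((z - y) / (z - x)) * x + (1 - (z - y) / (z - x)) * z.
    by field; rewrite gt_eqF.
  by apply: cvxL; rewrite ?divr_ge0 ?ler_pdivrMr //; lra.
exists l; split => // [lam /andP[lam0 laml]|].
  have [t [t0 t1]] := conv _ _ _ laml llt; rewrite Ll => h; nra.
exists (Num.min (3 / 2) (l0 / l)).
  have r1 : 1 < l0 / l by rewrite ltr_pdivlMr // mul1r.
  by rewrite lt_min gt_min r1; apply/andP; split; [lra | apply/orP; left; lra].
move=> lam /andP[llam lamlt].
have lam0 : lam < l0.
  by apply: lt_le_trans lamlt _; rewrite -ler_pdivlMr // ge_min lexx orbT.
have [t [t0 t1]] := conv _ _ _ llam lam0; rewrite Ll => h; nra.
Qed.

Section Dispersion.
Context {R : realType}.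
Notation mu := (@lebesgue_measure R).
Variables (k : R -> R) (bk : borel_kernel k).

(** The function [Lambda] of a Borel kernel, with the speed factored out of the integral. *)
Definition dispersion (k : R -> R) (d c lam : R) := (1 + d) * (expR (- (lam * c)) * mgf k lam).

Lemma avgable_exp_shift lam c : avgable k (fun z => expR (lam * (z - c))).
Proof.
have := avgableZ (expR (- (lam * c))) (avgable_exp bk lam).
by congr avgable; apply/funext => z /=; rewrite -expRD mulrBr addrC.
Qed.

Lemma dispersionE d c lam :
  dispersion k d c lam = (1 + d) * avg k (fun z => expR (lam * (z - c))).
Proof.
rewrite /dispersion /mgf -(avgZ _ (avgable_exp bk lam)).
by congr (_ * avg _ _); apply/funext => z /=; rewrite -expRD mulrBr addrC.
Qed.

(** Both end points lie above the tangent at the intermediate point. *)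
Lemma expR_convex (t x y : R) : 0 <= t -> t <= 1 ->
  expR (t * x + (1 - t) * y) <= t * expR x + (1 - t) * expR y.
Proof.
move=> t0 t1; set w := t * x + (1 - t) * y.
have tangent v : expR w * (1 + (v - w)) <= expR v.
  have -> : expR v = expR w * expR (v - w) by rewrite -expRD addrC subrK.
  by rewrite ler_wpM2l ?expR_ge0 // expR_ge1Dx.
have : t * (expR w * (1 + (x - w))) <= t * expR x by rewrite ler_wpM2l.
have : (1 - t) * (expR w * (1 + (y - w))) <= (1 - t) * expR y.
  by rewrite ler_wpM2l // subr_ge0.
have : expR w = t * (expR w * (1 + (x - w))) + (1 - t) * (expR w * (1 + (y - w))).
  by rewrite /w; ring.
lra.
Qed.

Lemma dispersion_convex d c t x y : 0 < d -> 0 <= t -> t <= 1 ->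
  dispersion k d c (t * x + (1 - t) * y) <=
  t * dispersion k d c x + (1 - t) * dispersion k d c y.
Proof.
move=> d0 t0 t1; have d1 : 0 <= 1 + d by lra.
rewrite !dispersionE (mulrCA t) (mulrCA (1 - t)) -mulrDr ler_wpM2l //.
have i z := avgable_exp_shift z c.
rewrite -(avgZ t (i x)) -(avgZ (1 - t) (i y)) -(avgD (avgableZ t (i x)) (avgableZ (1 - t) (i y))).
apply: (le_avg bk) => // [|z]; first exact: (avgableD (avgableZ t (i x)) (avgableZ (1 - t) (i y))).
by rewrite mulrDl -!mulrA; exact: expR_convex.
Qed.

Lemma continuous_dispersion d c : continuous (dispersion k d c).
Proof.
move=> lam; apply: cvgM; first exact: cvg_cst.
apply: cvgM; last exact: continuous_mgf.
apply: continuous_comp; last exact: continuous_expR.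
by apply: cvgN; apply: cvgM; [exact: cvg_id | exact: cvg_cst].
Qed.

Lemma dispersion0 d c : 0 < d -> 1 < dispersion k d c 0.
Proof.
move=> d0; rewrite /dispersion mul0r oppr0 expR0 mul1r.
have := mgf_ge1 bk 0; nra.
Qed.

End Dispersion.

Section Transfer.
Context {R : realType}.
Notation mu := (@lebesgue_measure R).

Lemma speed_bound_lt (m : nat) (d : 'I_m -> R) (k : 'I_m -> R -> R) (c : R) :
  (speed_bound d k < c%:E)%E -> forall i, exists2 lam, 0 < lam &
    ln ((1 + d i) * \int[leb]_y (expR (lam * y) * k i y)) < c * lam.
Proof.
move=> hc i.
pose S j : set (\bar R) :=
  [set (ln ((1 + d j) * \int[leb]_y (expR (lam * y) * k j y)) / lam)%:E
    | lam in [set lam : R | 0 < lam]].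
have : (ereal_inf (S i) < c%:E)%E.
  apply: le_lt_trans hc.
  exact: (@le_bigmax _ _ _ -oo%E (fun j => ereal_inf (S j)) i).
move=> /ereal_inf_lt[_ [lam /= lam0 <-]]; rewrite lte_fin ltr_pdivrMr // => h.
by exists lam.
Qed.

Variables (k0 k : R -> R) (bk : borel_kernel k).
Hypothesis kk : forall g : R -> R, measurable_fun setT g -> (forall x, 0 <= g x) ->
  \int[leb]_y (g y * k0 y) = \int[mu]_y (g y * k y).

Lemma LambdaE d lam c : Lambda d k0 lam c = dispersion k d c lam.
Proof.
rewrite dispersionE // /Lambda (kk (g := fun y => expR (lam * y - lam * c))).
- by congr (_ * _); apply: eq_Rintegral => y _; rewrite mulrBr.
- exact: measurable_expR_affine.
- by move=> x; exact: expR_ge0.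
Qed.

Lemma mgfE lam : \int[leb]_y (expR (lam * y) * k0 y) = mgf k lam.
Proof. by apply: kk => [|x]; [exact: measurable_expRM | exact: expR_ge0]. Qed.

Lemma dispersion_lt1 d c lam : 0 < d -> 0 < lam ->
  ln ((1 + d) * \int[leb]_y (expR (lam * y) * k0 y)) < c * lam ->
  dispersion k d c lam < 1 /\ 0 < c.
Proof.
rewrite mgfE => d0 lam0 h; have M1 := mgf_ge1 bk lam.
have p0 : 0 < (1 + d) * mgf k lam by nra.
have {}h : (1 + d) * mgf k lam < expR (c * lam).
  by rewrite -(lnK p0) ltr_expR.
split.
  rewrite /dispersion mulrCA expRN mulrC ltr_pdivrMr ?expR_gt0 // mul1r.
  by rewrite [lam * c]mulrC.
have : expR 0 < expR (c * lam) by apply: lt_trans h; rewrite expR0; nra.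
by rewrite ltr_expR pmulr_lgt0.
Qed.

Lemma is_lambda_cE d c : 0 < d -> (exists2 lam, 0 < lam & dispersion k d c lam < 1) ->
  is_lambda_c d k0 c (lambda_c d k0 c).
Proof.
move=> d0 [l0 l00 hl0]; have [l [l1 l2 l3 [eta he l4]]] := convex_unit_crossing
  (fun t x y => @dispersion_convex _ _ bk d c t x y d0) (@continuous_dispersion _ _ bk d c)
  (dispersion0 bk c d0) l00 hl0.
apply: (xgetPex 0 (P := [set l | is_lambda_c d k0 c l])); exists l; split => //.
- by rewrite LambdaE.
- by move=> lam /l3; rewrite LambdaE.
- by exists eta => // lam /l4; rewrite LambdaE.
Qed.

End Transfer.

(** * Growth under competition *)

Section Growth.
Variable R : realType.
Implicit Types u v P Q : R.

Definition growth (d u P : R) := (1 + d) * u / (1 + d * (u + P)).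

Lemma growth_den (d : R) (d0 : 0 < d) u P : 0 <= u -> 0 <= P -> 1 <= 1 + d * (u + P).
Proof. by move=> u0 P0; rewrite lerDl mulr_ge0 ?addr_ge0 // ltW. Qed.

Lemma growth_den_gt0 (d : R) (d0 : 0 < d) u P : 0 <= u -> 0 <= P -> 0 < 1 + d * (u + P).
Proof. by move=> u0 P0; apply: lt_le_trans (growth_den d0 u0 P0). Qed.

Lemma growth_ge0 (d : R) (d0 : 0 < d) u P : 0 <= u -> 0 <= P -> 0 <= growth d u P.
Proof.
move=> u0 P0; rewrite divr_ge0 //; first by rewrite mulr_ge0 //; lra.
exact: ltW (growth_den_gt0 d0 u0 P0).
Qed.

Lemma growth_gt0 (d : R) (d0 : 0 < d) u P : 0 < u -> 0 <= P -> 0 < growth d u P.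
Proof.
move=> u0 P0; rewrite divr_gt0 //; first by rewrite mulr_gt0 //; lra.
exact: (growth_den_gt0 d0 (ltW u0) P0).
Qed.

Lemma growth_le1 (d : R) (d0 : 0 < d) u P : 0 <= u -> 0 <= P -> u <= 1 -> growth d u P <= 1.
Proof.
move=> u0 P0 u1; rewrite ler_pdivrMr ?growth_den_gt0 // mul1r.
by have := mulr_ge0 (ltW d0) P0; lra.
Qed.

Lemma growth_lt1 (d : R) (d0 : 0 < d) u P : 0 <= u -> 0 <= P -> u < 1 -> growth d u P < 1.
Proof.
move=> u0 P0 u1; rewrite ltr_pdivrMr ?growth_den_gt0 // mul1r.
by have := mulr_ge0 (ltW d0) P0; lra.
Qed.

Lemma growth_le_linear (d : R) (d0 : 0 < d) u P : 0 <= u -> 0 <= P -> growth d u P <= (1 + d) * u.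
Proof.
move=> u0 P0; rewrite ler_pdivrMr ?growth_den_gt0 // ler_peMr ?growth_den //.
by rewrite mulr_ge0 //; lra.
Qed.

(** From [1 / (1 + x) >= 1 - x]. *)
Lemma growth_ge_quadratic (d : R) (d0 : 0 < d) u P : 0 <= u -> 0 <= P ->
  (1 + d) * (u - d * (u * (u + P))) <= growth d u P.
Proof.
move=> u0 P0; rewrite ler_pdivlMr ?growth_den_gt0 // -mulrA ler_wpM2l //; first by lra.
have -> : (u - d * (u * (u + P))) * (1 + d * (u + P)) = u - u * (d * (u + P)) ^+ 2 by ring.
by rewrite gerBl mulr_ge0 // sqr_ge0.
Qed.

Lemma growth_lipschitz (d : R) (d0 : 0 < d) u v P Q : 0 <= u -> 0 <= v <= 1 -> 0 <= P -> 0 <= Q ->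
  `|growth d u P - growth d v Q| <= (1 + d) * (`|u - v| + d * `|P - Q|).
Proof.
move=> u0 /andP[v0 v1] P0 Q0.
have D1 := growth_den d0 u0 P0; have D2 := growth_den d0 v0 Q0.
have D10 := growth_den_gt0 d0 u0 P0; have D20 := growth_den_gt0 d0 v0 Q0.
have -> : growth d u P - growth d v Q =
   (1 + d) * ((u - v) * ((1 + d * Q) / (1 + d * (v + Q))) + d * (Q - P) * (v / (1 + d * (v + Q))))
     / (1 + d * (u + P)).
  by rewrite /growth; field; rewrite !gt_eqF.
have r1 : 0 <= (1 + d * Q) / (1 + d * (v + Q)) <= 1.
  have := mulr_ge0 (ltW d0) Q0; have := mulr_ge0 (ltW d0) v0 => h1 h2.
  by rewrite divr_ge0 ?ler_pdivrMr ?mul1r //; lra.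
have r2 : 0 <= v / (1 + d * (v + Q)) <= 1.
  by rewrite divr_ge0 ?ler_pdivrMr ?mul1r //; lra.
rewrite normrM normfV (gtr0_norm D10) ler_pdivrMr //.
apply: (@le_trans _ _ ((1 + d) * (`|u - v| + d * `|P - Q|))); last first.
  rewrite ler_peMr // mulr_ge0 //; first by lra.
  by rewrite addr_ge0 // mulr_ge0 // ltW.
rewrite normrM ger0_norm; last by lra.
rewrite ler_wpM2l //; first by lra.
move/andP: r1 => [r10 r11]; move/andP: r2 => [r20 r21].
rewrite (le_trans (ler_normD _ _)) // lerD //.
  by rewrite normrM (ger0_norm r10) ler_piMr.
have -> : d * `|P - Q| = `|d * (Q - P)| by rewrite normrM (gtr0_norm d0) distrC.
by rewrite normrM (ger0_norm r20) ler_piMr.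
Qed.

End Growth.

Lemma continuous_sum (R : realType) (I : Type) (r : seq I) (P : pred I) (F : I -> R -> R) :
  (forall i, continuous (F i)) -> continuous (fun y => \sum_(i <- r | P i) F i y).
Proof.
move=> cF; elim: r => [|i r IH].
  rewrite (_ : (fun y => _) = cst 0); first exact: cst_continuous.
  by apply/funext => y; rewrite big_nil.
have [Pi|/negbTE Pi] := boolP (P i).
  rewrite (_ : (fun y => _) = (fun y => F i y + \sum_(i <- r | P i) F i y)).
    by move=> y; apply: cvgD; [exact: cF | exact: IH].
  by apply/funext => y; rewrite big_cons Pi.
rewrite (_ : (fun y => _) = (fun y => \sum_(i <- r | P i) F i y)) //.
by apply/funext => y; rewrite big_cons Pi.
Qed.

Section Competition.
Variables (R : realType) (m tau : nat) (e : 'I_m -> nat -> R) (f : 'I_m -> 'I_m -> nat -> R).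
Variable c : R.
Implicit Types u v : 'I_m * R -> R.

Definition competition u (i : 'I_m) (y : R) : R :=
  \sum_(1 <= j < tau) e i j * u (i, y - c * j%:R)
    + \sum_(1 <= j < tau.+1) \sum_(l < m | l != i) f i l j * u (l, y - c * j%:R + c).

Lemma competitionD u v i y :
  competition (fun p => u p + v p) i y = competition u i y + competition v i y.
Proof.
rewrite /competition addrACA -!big_split /=; congr (_ + _).
  by apply: eq_bigr => j _; rewrite mulrDr.
by apply: eq_bigr => j _; rewrite -big_split; apply: eq_bigr => l _; rewrite mulrDr.
Qed.

Definition competition_weight i := competition (cst 1) i 0.

Lemma competition_cst r i y : competition (cst r) i y = r * competition_weight i.
Proof.
rewrite /competition_weight /competition mulrDr !mulr_sumr; congr (_ + _).
  by apply: eq_bigr => j _; rewrite mulr1 mulrC.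
apply: eq_bigr => j _; rewrite mulr_sumr; apply: eq_bigr => l _.
by rewrite mulr1 mulrC.
Qed.

Lemma continuous_competition u i : (forall l, continuous (fun x => u (l, x))) ->
  continuous (competition u i).
Proof.
move=> cu.
have shift l (a b : R) : continuous (fun y => a * u (l, y + b)).
  move=> y; apply: cvgM; first exact: cvg_cst.
  apply: (@continuous_comp _ _ _ (fun y => y + b) (fun x => u (l, x))); last exact: cu.
  by apply: cvgD; [exact: cvg_id | exact: cvg_cst].
move=> y; apply: cvgD.
  by apply: (@continuous_sum R) => j; exact: shift.
apply: (@continuous_sum R) => j; apply: (@continuous_sum R) => l.
rewrite (_ : (fun y => _) = fun y => f i l j * u (l, y + (- (c * j%:R) + c))) //.
by apply/funext => x; rewrite addrA.
Qed.

Hypotheses (c0 : 0 < c).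
Hypothesis he : forall (i : 'I_m) (j : nat), (1 <= j <= tau.-1)%N -> 0 <= e i j.
Hypothesis hf : forall (i l : 'I_m) (j : nat), l != i -> (1 <= j <= tau)%N -> 0 <= f i l j.

(** As [c > 0] and the delays in the second sum are at least 1, the places involved lie between
    [y - c tau] and [y]. *)
Lemma le_competition u v i y :
  (forall l x, y - c * tau%:R <= x -> x <= y -> u (l, x) <= v (l, x)) ->
  competition u i y <= competition v i y.
Proof.
move=> uv; have c0' := c0; apply: lerD.
  apply: ler_sum_nat => j /andP[j1 jt]; apply: ler_wpM2l; first by apply: he; lia.
  apply: uv; first by rewrite lerD2l lerN2 ler_wpM2l ?(ltW c0) // ler_nat ltnW.
  by rewrite gerBl mulr_ge0 // ltW.
apply: ler_sum_nat => j /andP[j1 jt]; apply: ler_sum => l li.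
apply: ler_wpM2l; first by apply: hf => //; lia.
have j1' : 1 <= j%:R :> R by rewrite ler1n.
have jt' : j%:R <= tau%:R :> R by rewrite ler_nat.
apply: uv; nra.
Qed.

Lemma competition_weight_ge0 i : 0 <= competition_weight i.
Proof.
have -> : 0 = competition (cst 0) i 0 by rewrite competition_cst mul0r.
by apply: le_competition => l x _ _; exact: ler01.
Qed.

Lemma competition_ge0 u i y : (forall p, 0 <= u p) -> 0 <= competition u i y.
Proof.
move=> u0; have <- : competition (cst 0) i y = 0 by rewrite competition_cst mul0r.
exact: le_competition.
Qed.

Lemma competition_lipschitz u v i y (eta : R) :
  (forall l x, y - c * tau%:R <= x -> x <= y -> `|u (l, x) - v (l, x)| <= eta) ->
  `|competition u i y - competition v i y| <= eta * competition_weight i.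
Proof.
move=> uv.
have : competition u i y <= competition (fun p => v p + cst eta p) i y.
  by apply: le_competition => l x h1 h2; have := uv l x h1 h2; rewrite ler_norml /cst; lra.
have : competition v i y <= competition (fun p => u p + cst eta p) i y.
  by apply: le_competition => l x h1 h2; have := uv l x h1 h2; rewrite ler_norml /cst; lra.
by rewrite !competitionD !competition_cst ler_norml; lra.
Qed.

End Competition.

(** * The wave operator and its invariant set *)

Section Wave.
Variables (R : realType) (m tau : nat) (e : 'I_m -> nat -> R) (f : 'I_m -> 'I_m -> nat -> R).
Variables (d : 'I_m -> R) (k : 'I_m -> R -> R) (c : R).
Hypothesis c0 : 0 < c.
Hypothesis he : forall (i : 'I_m) (j : nat), (1 <= j <= tau.-1)%N -> 0 <= e i j.
Hypothesis hf : forall (i l : 'I_m) (j : nat), l != i -> (1 <= j <= tau)%N -> 0 <= f i l j.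
Hypothesis hd : forall i, 0 < d i.
Hypothesis bk : forall i, borel_kernel (k i).
Notation mu := (@lebesgue_measure R).
Implicit Types u v : 'I_m * R -> R.

Local Notation comp := (competition tau e f c).
Local Notation weight i := (competition_weight tau e f c i).

Definition repro u i y := growth (d i) (u (i, y)) (comp u i y).

Definition step u (p : 'I_m * R) := avg (k p.1) (fun z => repro u p.1 (p.2 - c - z)).

(** What the operator needs for its integrals to make sense and to stay between 0 and 1. *)
Definition tame u := (forall l, continuous (fun x => u (l, x))) /\ forall p, 0 <= u p <= 1.

Lemma tame_ge0 u p : tame u -> 0 <= u p. Proof. by move=> [_ /(_ p) /andP[]]. Qed.
Lemma tame_le1 u p : tame u -> u p <= 1. Proof. by move=> [_ /(_ p) /andP[]]. Qed.
Lemma tame_comp_ge0 u i y : tame u -> 0 <= comp u i y.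
Proof. by move=> tu; apply: competition_ge0 => // p; exact: tame_ge0. Qed.

Lemma repro_ge0 u i y : tame u -> 0 <= repro u i y.
Proof. by move=> tu; apply: growth_ge0; [exact: hd | exact: tame_ge0 | exact: tame_comp_ge0]. Qed.

Lemma repro_le1 u i y : tame u -> repro u i y <= 1.
Proof.
by move=> tu; apply: growth_le1; [exact: hd | exact: tame_ge0 | exact: tame_comp_ge0 | exact: tame_le1].
Qed.

Lemma continuous_repro u i : tame u -> continuous (repro u i).
Proof.
move=> tu y; have cu := tu.1; have cc := @continuous_competition _ _ tau e f c u i cu.
apply: cvgM; first by apply: cvgM; [exact: cvg_cst | exact: cu].
apply: cvgV.
  by rewrite gt_eqF // growth_den_gt0 //; [exact: tame_ge0 | exact: tame_comp_ge0].
apply: cvgD; first exact: cvg_cst.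
by apply: cvgM; [exact: cvg_cst | apply: cvgD; [exact: cu | exact: cc]].
Qed.

Lemma measurable_repro u i : tame u -> measurable_fun setT (repro u i).
Proof. by move=> tu; apply: continuous_measurable_fun; exact: continuous_repro. Qed.

Lemma avgable_repro u i x : tame u -> avgable (k i) (fun z => repro u i (x - z)).
Proof.
move=> tu; apply: (@avgable_bounded _ _ (bk i) 1).
  by apply: (measurableT_comp (measurable_repro i tu)); exact: measurable_reflection.
by move=> z; rewrite ger0_norm ?repro_le1 ?repro_ge0.
Qed.

Definition modulus i (h : R) := \int[mu]_z `|k i (z + h) - k i z|.

Lemma step_convolution u i x : tame u ->
  L1 (fun y => repro u i y * k i (x - c - y)) /\
  step u (i, x) = \int[mu]_y (repro u i y * k i (x - c - y)).
Proof.
move=> tu; have h := avgable_repro i (x - c) tu.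
have e1 : (fun y => repro u i y * k i (x - c - y)) =
    (fun y => (fun z => repro u i (x - c - z) * k i z) (x - c - y)).
  by apply/funext => y /=; rewrite subKr.
rewrite e1; split; first exact: (integrable_reflection (x - c) h).
by rewrite (Rintegral_reflection (x - c) h).
Qed.

(** Moving the shift from the growth term to the kernel turns regularity of [step u] into
    regularity of the kernel, whatever [u] is. *)
Lemma step_modulus u i x y : tame u ->
  `|step u (i, x) - step u (i, y)| <= modulus i (x - y).
Proof.
move=> tu; have [ix ->] := step_convolution i x tu; have [iy ->] := step_convolution i y tu.
have kr a : L1 (fun w => k i (a - w)) by exact: (integrable_reflection a (kernel_L1 (bk i))).
have id : L1 (fun w => `|k i (x - c - w) - k i (y - c - w)|) by apply/L1_norm/L1B.
rewrite -RintegralB // (le_trans (le_normr_Rintegral _ (L1B ix iy))) //.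
apply: (@le_trans _ _ (\int[mu]_w `|k i (x - c - w) - k i (y - c - w)|)).
  apply: le_Rintegral => //; first exact: (L1_norm (L1B ix iy)).
  move=> w _; rewrite -mulrBr normrM ger0_norm ?repro_ge0 //.
  by rewrite ler_piMl // repro_le1.
have ih : L1 (fun z => `|k i (z + (x - y)) - k i z|).
  by apply/L1_norm/L1B; [exact: (L1_translate _ (kernel_L1 (bk i))) | exact: kernel_L1].
rewrite /modulus -(Rintegral_reflection (y - c) ih) le_eqVlt; apply/orP; left; apply/eqP.
by apply: eq_Rintegral => w _; congr `|k i _ - _|; ring.
Qed.

Lemma modulus_small (eta : R) : 0 < eta -> exists2 r : R, 0 < r &
  forall i h, `|h| < r -> modulus i h < eta.
Proof.
move=> eta0; have /choice[r hr] : forall i, exists r : R, 0 < r /\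
    forall h, `|h| < r -> modulus i h < eta.
  by move=> i; have [r r0 h] := L1_translation_continuous (kernel_L1 (bk i)) eta0; exists r.
exists (\big[Num.min/1]_i r i) => [|i h hh].
  by apply/bigmin_gtP; split=> [|i _]; [exact: ltr01 | have [] := hr i].
by have [_] := hr i; apply; apply: lt_le_trans hh _; exact: bigmin_le_cond.
Qed.

Variables (lam : 'I_m -> R) (theta q : R).
Hypothesis lam0 : forall i, 0 < lam i.
Hypotheses (theta0 : 0 < theta) (theta_le : forall i, theta <= lam i).
Hypothesis disp_lam : forall i, dispersion (k i) (d i) c (lam i) = 1.
Hypothesis q1 : 1 <= q.
Hypothesis hq : forall i,
  (q + d i * (1 + weight i)) * dispersion (k i) (d i) c (lam i + theta) <= q.

Definition upper i (x : R) := Num.min (expR (lam i * x)) 1.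
Definition lower i (x : R) :=
  Num.max 0 (expR (lam i * x) - q * expR ((lam i + theta) * x)).

Definition between u := forall i x, lower i x <= u (i, x) <= upper i x.

Lemma upper_ge0 i x : 0 <= upper i x.
Proof. by rewrite le_min expR_ge0 ler01. Qed.

Lemma lower_le_upper i x : lower i x <= upper i x.
Proof.
rewrite ge_max upper_ge0 /= le_min; have q1' := q1.
have e0 := expR_ge0 ((lam i + theta) * x); rewrite gerBl mulr_ge0 //=; last by lra.
have [x0|x0] := leP x 0.
  have : expR (lam i * x) <= 1 by rewrite -expR0 ler_expR mulr_ge0_le0 // ltW.
  by have := mulr_ge0 (le_trans ler01 q1') e0; lra.
have : expR (lam i * x) <= expR ((lam i + theta) * x).
  by rewrite ler_expR mulrDl lerDl mulr_ge0 // ltW.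
have : expR ((lam i + theta) * x) <= q * expR ((lam i + theta) * x) by rewrite ler_peMl.
lra.
Qed.

(** For [y <= 0] this is where [theta <= lam i] is used; for [y >= 0] the right-hand side is at least 1. *)
Lemma upper_le_theta i x y : x <= y -> upper i x <= expR (theta * y).
Proof.
move=> xy; have [y0|y0] := leP 0 y.
  rewrite /upper ge_min; apply/orP; right.
  by rewrite -expR0 ler_expR mulr_ge0 // ltW.
rewrite /upper ge_min; apply/orP; left; rewrite ler_expR.
have tl := theta_le i; have t0 := theta0; nra.
Qed.

Lemma avg_exp_dispersion i a x :
  (1 + d i) * avg (k i) (fun z => expR (a * (x - c - z))) =
  expR (a * x) * dispersion (k i) (d i) c a.
Proof.
rewrite (avg_exp_conv (bk i)) /dispersion mulrBr expRD.
by rewrite -!mulrA mulrCA.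
Qed.

Lemma step_le_upper u i x : tame u -> between u -> step u (i, x) <= upper i x.
Proof.
move=> tu bu; rewrite le_min; apply/andP; split.
  have h := avgable_exp_conv (bk i) (lam i) (x - c).
  rewrite -[leRHS]mulr1 -(disp_lam i) -avg_exp_dispersion -(avgZ _ h).
  apply: (le_avg (bk i)); [exact: avgable_repro | exact: avgableZ|move=> z /=].
  apply: le_trans (growth_le_linear (hd i) (tame_ge0 _ tu) (tame_comp_ge0 _ _ tu)) _.
  apply: ler_wpM2l; first by rewrite addr_ge0 // ltW.
  by have /andP[_] := bu i (x - c - z); rewrite le_min => /andP[].
rewrite -(avg_cst (bk i) 1).
apply: (le_avg (bk i)) => [||z]; [exact: avgable_repro | exact: avgable_cst | exact: repro_le1].
Qed.

(** The species itself is at most [exp (lam i y)], and its sum with the competition is at most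
    [(1 + weight i) exp (theta y)]: the quadratic loss has the order of [exp ((lam i + theta) y)]. *)
Lemma lower_le_repro u i y : tame u -> between u ->
  (1 + d i) * expR (lam i * y)
    + - ((1 + d i) * (q + d i * (1 + weight i))) * expR ((lam i + theta) * y) <= repro u i y.
Proof.
move=> tu bu; have u0 := tame_ge0 (i, y) tu; have P0 := tame_comp_ge0 i y tu.
apply: le_trans (growth_ge_quadratic (hd i) u0 P0).
have -> : (1 + d i) * expR (lam i * y)
    + - ((1 + d i) * (q + d i * (1 + weight i))) * expR ((lam i + theta) * y)
  = (1 + d i) * ((expR (lam i * y) - q * expR ((lam i + theta) * y))
      - d i * (expR (lam i * y) * (expR (theta * y) * (1 + weight i)))).
  by rewrite [(lam i + theta) * y]mulrDl expRD; ring.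
have d1 := hd i; apply: ler_wpM2l; first by lra.
have /andP[lu uu] := bu i y.
apply: lerB; first by apply: le_trans lu; rewrite le_max lexx orbT.
apply: ler_wpM2l; first exact: ltW.
apply: ler_pM => //; first exact: addr_ge0.
  by apply: le_trans uu _; rewrite ge_min lexx.
rewrite mulrDr mulr1; apply: lerD.
  by apply: le_trans uu _; exact: upper_le_theta.
rewrite -(competition_cst tau e f c _ i y); apply: le_competition => // l x _ xy.
have /andP[_ ux] := bu l x; apply: le_trans ux _; exact: upper_le_theta.
Qed.

(** Averaging multiplies the two exponentials by 1 and by a factor less than 1; the choice of [q] lets
    the latter absorb the quadratic loss. *)
Lemma lower_le_step u i x : tame u -> between u -> lower i x <= step u (i, x).
Proof.
move=> tu bu; rewrite ge_max; apply/andP; split.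
  rewrite -(avg_cst (bk i) 0).
  by apply: (le_avg (bk i)) => [||z]; [exact: avgable_cst | exact: avgable_repro | exact: repro_ge0].
set Q := q + d i * (1 + weight i).
have h1 := avgable_exp_conv (bk i) (lam i) (x - c).
have h2 := avgable_exp_conv (bk i) (lam i + theta) (x - c).
have : avg (k i) (fun z => (1 + d i) * expR (lam i * (x - c - z))
   + - ((1 + d i) * Q) * expR ((lam i + theta) * (x - c - z))) <= step u (i, x).
  apply: (le_avg (bk i)).
  - by apply: avgableD; exact: avgableZ.
  - exact: avgable_repro.
  - by move=> z; exact: lower_le_repro.
apply: le_trans.
rewrite (avgD (avgableZ _ h1) (avgableZ _ h2)) (avgZ _ h1) (avgZ _ h2).
rewrite avg_exp_dispersion disp_lam mulr1 lerD2l mulNr lerN2.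
rewrite mulrAC avg_exp_dispersion -mulrA mulrC ler_wpM2r ?expR_ge0 //.
by rewrite mulrC; exact: hq.
Qed.

Definition wave_set u := between u /\
  forall i x y, `|u (i, x) - u (i, y)| <= modulus i (x - y).

Lemma wave_set_tame u : wave_set u -> tame u.
Proof.
move=> [bu wu]; split=> [l x|[i x]].
  apply/(@cvgrPdist_lt _ R) => eta eta0; have [r r0 hr] := modulus_small eta0.
  apply/nbhs_ballP; exists r => // y; rewrite /ball /= => xy.
  by apply: le_lt_trans (wu l x y) _; exact: hr.
have /andP[lu uu] := bu i x; apply/andP; split.
  by apply: le_trans lu; rewrite le_max lexx.
by apply: le_trans uu _; rewrite ge_min lexx orbT.
Qed.

Lemma step_wave_set u : tame u -> between u -> wave_set (step u).
Proof.
move=> tu bu; split=> [i x|i x y]; last exact: step_modulus.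
by rewrite lower_le_step ?step_le_upper.
Qed.

Lemma wave_set_nonempty : wave_set !=set0.
Proof.
exists (step (fun p => upper p.1 p.2)); apply: step_wave_set.
  split=> [l x|[i x]]; last by rewrite upper_ge0 /= ge_min lexx orbT.
  apply: (@continuous_min R R (fun x => expR (lam l * x)) (cst 1)); last exact: cvg_cst.
  apply: (@continuous_comp _ _ _ (fun x => lam l * x) expR); last exact: continuous_expR.
  by apply: cvgM; [exact: cvg_cst | exact: cvg_id].
by move=> i x /=; rewrite lower_le_upper lexx.
Qed.

Lemma wave_set_convex : convex_closed wave_set.
Proof.
move=> T t v [t0 t1] Kv; split=> [i x|i x y].
  have st r : r = \sum_a t a * r by rewrite -mulr_suml t1 mul1r.
  rewrite [lower i x]st [upper i x]st; apply/andP; split; apply: ler_sum => a _;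
  by apply: ler_wpM2l => //; have [/(_ i x) /andP[]] := Kv a.
rewrite -sumrB (le_trans (ler_norm_sum _ _ _)) //.
rewrite -[leRHS]mul1r -t1 mulr_suml; apply: ler_sum => a _.
rewrite -mulrBr normrM ger0_norm //; apply: ler_wpM2l => //.
by have [_] := Kv a; apply.
Qed.

Lemma wave_set_closed : pointwise_closed wave_set.
Proof.
move=> u hu; split=> [i x|i x y].
  apply/andP; split; apply/ler_addgt0Pr => eta eta0;
  have [v [bv _] /(_ _ (mem_head _ _))] := hu [:: (i, x)] _ eta0;
  by have /andP[] := bv i x; rewrite ltr_norml; lra.
apply/ler_addgt0Pr => eta eta0; have eta20 : 0 < eta / 2 by rewrite divr_gt0.
have [v [_ wv] hv] := hu [:: (i, x); (i, y)] _ eta20.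
have := hv (i, x) (mem_head _ _); have := hv (i, y); rewrite !inE eqxx orbT => /(_ isT).
by have := wv i x y; rewrite !ltr_norml !ler_norml; lra.
Qed.

(** Functions with a common modulus of continuity that are close on a fine mesh of [[- X, X]] are close
    on the whole interval. *)
Lemma wave_set_mesh (X eta : R) : 0 < eta -> exists (P : seq ('I_m * R)) (del : R),
  0 < del /\ forall u v, wave_set u -> wave_set v ->
    (forall p, p \in P -> `|u p - v p| < del) ->
    forall l x, `|x| <= X -> `|u (l, x) - v (l, x)| <= eta.
Proof.
move=> eta0; have eta30 : 0 < eta / 3 by rewrite divr_gt0.
have [r r0 hr] := modulus_small eta30.
pose s := r / 2; have s0 : 0 < s by rewrite divr_gt0.
have sr : s < r by rewrite /s; lra.
pose N := (Num.trunc (2 * X / s)).+1.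
pose P := [seq (l, - X + j%:R * s) | l <- enum 'I_m, j <- iota 0 N].
exists P, (eta / 3); split => // u v [_ wu] [_ wv] huv l x xX.
have /andP[Xx xX'] : - X <= x <= X by rewrite -ler_norml.
have y0 : 0 <= (x + X) / s by rewrite divr_ge0 ?(ltW s0) //; lra.
pose j := Num.trunc ((x + X) / s).
have /andP[j1 j2] : j%:R <= (x + X) / s < j.+1%:R by exact: truncn_itv.
have jN : (j < N)%N.
  rewrite ltnS; apply: le_truncn; rewrite ler_pM2r ?invr_gt0 //; lra.
set y := - X + j%:R * s.
have yP : (l, y) \in P.
  by apply: (allpairs_f (fun l j => (l, - X + j%:R * s))); rewrite ?mem_enum ?mem_iota.
have xy : `|x - y| < r.
  move: j1 j2; rewrite ler_pdivlMr // ltr_pdivrMr // -natr1 mulrDl mul1r => j1 j2.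
  by rewrite /y ltr_norml; lra.
have := huv _ yP; have := hr l _ xy; have := wu l x y; have := wv l x y.
by rewrite !ltr_norml !ler_norml; lra.
Qed.

Lemma repro_lipschitz u v i y (eta : R) : tame u -> tame v ->
  (forall l x, y - c * tau%:R <= x -> x <= y -> `|u (l, x) - v (l, x)| <= eta) ->
  `|repro u i y - repro v i y| <= (1 + d i) * (1 + d i * weight i) * eta.
Proof.
move=> tu tv uv; have d1 := hd i.
apply: le_trans (growth_lipschitz (hd i) _ _ _ _) _.
- exact: tame_ge0.
- by rewrite tame_ge0 ?tame_le1.
- exact: tame_comp_ge0.
- exact: tame_comp_ge0.
rewrite -mulrA ler_wpM2l //; first by lra.
have := competition_lipschitz c0 he hf i uv.
have ct : 0 <= c * tau%:R by rewrite mulr_ge0 // ltW.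
have := uv i y; rewrite lexx gerBl => /(_ ct isT).
by move=> h1 h2; have := ler_wpM2l (ltW d1) h2; lra.
Qed.

(** The kernel carries little mass far from 0: as [1 <= exp (- A) (exp z + exp (- z))] for [|z| >= A],
    places at distance at least [A] contribute at most [2 exp (- A)] times the average of [exp]. *)
Lemma step_lipschitz u v i x (A eta : R) : tame u -> tame v -> 0 <= eta ->
  (forall l y, `|y| <= `|x - c| + A + c * tau%:R -> `|u (l, y) - v (l, y)| <= eta) ->
  `|step u (i, x) - step v (i, x)| <=
    (1 + d i) * (1 + d i * weight i) * eta + expR (- A) * (2 * mgf (k i) 1).
Proof.
move=> tu tv eta0 uv; set C := (1 + d i) * _.
have C0 : 0 <= C.
  have d1 := hd i; have w0 := competition_weight_ge0 c0 he hf i.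
  by have := mulr_ge0 (ltW d1) w0; rewrite /C => h; apply: mulr_ge0; lra.
have ct : 0 <= c * tau%:R by rewrite mulr_ge0 // ltW.
have near z : `|repro u i (x - c - z) - repro v i (x - c - z)| <=
    C * eta + expR (- A) * (expR (1 * z) + expR (- 1 * z)).
  have t0 : 0 <= expR (- A) * (expR (1 * z) + expR (- 1 * z)).
    by rewrite mulr_ge0 ?addr_ge0 ?expR_ge0.
  have [zA|Az] := leP `|z| A.
    rewrite ler_wpDr // repro_lipschitz // => l y h1 h2; apply: uv.
    have := ler_norm (x - c); have := ler_norm (- (x - c)).
    move: zA; rewrite normrN !ler_norml; lra.
  apply: (@le_trans _ _ 1).
    have := repro_ge0 i (x - c - z) tu; have := repro_le1 i (x - c - z) tu.
    have := repro_ge0 i (x - c - z) tv; have := repro_le1 i (x - c - z) tv.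
    by rewrite ler_norml; lra.
  apply: ler_wpDl; first exact: mulr_ge0.
  rewrite expRN mulrC ler_pdivlMr ?expR_gt0 // mul1r mul1r mulN1r.
  apply: (@le_trans _ _ (expR `|z|)); first by rewrite ler_expR ltW.
  have p1 := expR_ge0 z; have p2 := expR_ge0 (- z).
  by have [z0|z0] := leP 0 z; [rewrite ger0_norm // lerDl | rewrite ltr0_norm // lerDr].
have iu := avgable_repro i (x - c) tu; have iv := avgable_repro i (x - c) tv.
have ip := avgable_exp (bk i) 1; have im := avgable_exp (bk i) (- 1).
have ib := avgableD (avgable_cst (bk i) (C * eta)) (avgableZ (expR (- A)) (avgableD ip im)).
have Eb : avg (k i) (fun z => cst (C * eta) z + expR (- A) * (expR (1 * z) + expR (- 1 * z))) =
    C * eta + expR (- A) * (2 * mgf (k i) 1).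
  rewrite (avgD (avgable_cst (bk i) (C * eta)) (avgableZ (expR (- A)) (avgableD ip im))).
  rewrite (avg_cst (bk i)) (avgZ _ (avgableD ip im)) (avgD ip im) -!/(mgf _ _).
  by rewrite (mgfN (bk i)); ring.
rewrite -Eb ler_norml; apply/andP; split.
  rewrite lerNl opprB lerBlDl /step /= -(avgD iu ib).
  apply: (le_avg (bk i)) => //; first exact: avgableD.
  by move=> z; have := near z; rewrite ler_norml /cst; lra.
rewrite lerBlDl /step /= -(avgD iv ib).
apply: (le_avg (bk i)) => //; first exact: avgableD.
by move=> z; have := near z; rewrite ler_norml /cst; lra.
Qed.

Lemma step_ucontinuous : pointwise_ucontinuous wave_set step.
Proof.
move=> [i x] eps eps0; set C := (1 + d i) * (1 + d i * weight i).
have C0 : 0 < C.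
  have d1 := hd i; have w0 := competition_weight_ge0 c0 he hf i.
  by have := mulr_ge0 (ltW d1) w0; rewrite /C => h; apply: mulr_gt0; lra.
set M := mgf (k i) 1; have M1 : 1 <= M := mgf_ge1 (bk i) 1.
(* exp A > A makes the tail exp (- A) * (2 M) smaller than eps / 2 *)
pose A := 4 * M / eps.
have tail : expR (- A) * (2 * M) < eps / 2.
  rewrite expRN mulrC ltr_pdivrMr ?expR_gt0 //.
  have : A < expR A by have := expR_ge1Dx A; lra.
  by rewrite /A ltr_pdivrMr // => h; lra.
pose eta := eps / (2 * C).
have eta0 : 0 < eta by rewrite divr_gt0 // mulr_gt0.
have [P [del [del0 hP]]] := wave_set_mesh (`|x - c| + A + c * tau%:R) eta0.
exists P, del; split => // u v Ku Kv uv.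
have tu := wave_set_tame Ku; have tv := wave_set_tame Kv.
have h := @step_lipschitz u v i x A eta tu tv (ltW eta0) (hP u v Ku Kv uv).
apply: le_lt_trans h _; rewrite -/C.
have -> : C * eta = eps / 2 by rewrite /eta; field; rewrite gt_eqF.
by rewrite -/M; lra.
Qed.

(** * Existence of the travelling wave *)

Lemma wave_exists : exists2 u, wave_set u & forall p, step u p = u p.
Proof.
apply: cube_fixed_point.
- exact: wave_set_nonempty.
- by move=> u /wave_set_tame[_ h] p; exact: h.
- exact: wave_set_convex.
- by move=> u Ku; apply: step_wave_set; [exact: wave_set_tame | have [] := Ku].
- exact: step_ucontinuous.
- exact: wave_set_closed.
Qed.

(** A property of [x] implied by that property up to [x - c] spreads to the whole line. *)
Lemma propagate (Q : R -> Prop) (x0 : R) : (forall x, x < x0 -> Q x) ->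
  (forall x, (forall y, y <= x - c -> Q y) -> Q x) -> forall x, Q x.
Proof.
move=> Q0 QS x; have c1 := c0.
have step_n n : forall y, y < x0 + n%:R * c -> Q y.
  elim: n => [|n IH] y; first by rewrite mul0r addr0; exact: Q0.
  rewrite -natr1 mulrDl mul1r => yn; apply: QS => z zy; apply: IH; lra.
apply: (step_n (Num.trunc ((x - x0) / c)).+1).
have : (x - x0) / c < (Num.trunc ((x - x0) / c)).+1%:R by exact: truncnS_gt.
by rewrite ltr_pdivrMr //; lra.
Qed.

(** The lower barrier is positive for [x < - q / theta], since [q exp (- q) < 1]. *)
Lemma wave_gt0 u : wave_set u -> (forall p, step u p = u p) -> forall i x, 0 < u (i, x).
Proof.
move=> Ku fu i; have tu := wave_set_tame Ku.
have q1' := q1; have th := theta0; have q0 : 0 < q by lra.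
apply: (@propagate _ (- (q / theta))) => x.
  move=> xq; have [/(_ i x) /andP[lu _] _] := Ku; apply: lt_le_trans lu.
  rewrite lt_max; apply/orP; right; rewrite subr_gt0 mulrDl expRD mulrCA gtr_pMr ?expR_gt0 //.
  have : theta * x < - q.
    by rewrite mulrC -ltr_pdivlMr // mulNr.
  rewrite -ltr_expR expRN => h.
  have : q * expR (theta * x) < q * (expR q)^-1 by rewrite ltr_pM2l.
  move/lt_le_trans; apply; rewrite ler_pdivrMr ?expR_gt0 // mul1r.
  by have := expR_ge1Dx q; lra.
move=> hx; rewrite -fu; apply: (avg_gt0 (bk i)) => /= [|z|z z0].
- exact: avgable_repro.
- exact: repro_ge0.
- apply: growth_gt0; [exact: hd | apply: hx; lra | exact: tame_comp_ge0].
Qed.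

(** The difference [1 - u] is the average of [1 - growth], positive at [x] as soon as
    [u < 1] up to [x - c]. *)
Lemma wave_lt1 u : wave_set u -> (forall p, step u p = u p) -> forall i x, u (i, x) < 1.
Proof.
move=> Ku fu i; have tu := wave_set_tame Ku.
apply: (@propagate _ 0) => x.
  move=> x0; have [/(_ i x) /andP[_ uu] _] := Ku; apply: le_lt_trans uu _.
  by rewrite gt_min -expR0 ltr_expR nmulr_llt0 // lam0.
move=> hx; have ir := avgable_repro i (x - c) tu.
have ic := avgable_cst (bk i) 1.
have inr := avgableZ (- 1) ir.
have : 0 < avg (k i) (fun z => cst 1 z + -1 * repro u i (x - c - z)).
  apply: (avg_gt0 (bk i)) => /= [|z|z z0].
  - exact: (avgableD ic inr).
  - by rewrite mulN1r subr_ge0 repro_le1.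
  - rewrite mulN1r subr_gt0; apply: growth_lt1;
      [exact: hd | exact: tame_ge0 | exact: tame_comp_ge0 | apply: hx; lra].
rewrite (avgD ic inr) (avg_cst (bk i)) (avgZ _ ir) mulN1r subr_gt0.
by rewrite -[X in X < _]/(step u (i, x)) fu.
Qed.

Lemma between_cvg u i : between u ->
  u (i, x) * expR (- lam i * x) @[x --> -oo%R] --> (1 : R).
Proof.
move=> bu; have th := theta0.
have gxp x : expR (lam i * x) * expR (- lam i * x) = 1.
  by rewrite -expRD mulNr subrr expR0.
have low x : 1 - q * expR (theta * x) <= u (i, x) * expR (- lam i * x).
  have -> : 1 - q * expR (theta * x) =
      (expR (lam i * x) - q * expR ((lam i + theta) * x)) * expR (- lam i * x).
    rewrite [(lam i + theta) * x]mulrDl expRD.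
    transitivity (expR (lam i * x) * expR (- lam i * x) * (1 - q * expR (theta * x))).
      by rewrite gxp mul1r.
    by ring.
  rewrite ler_wpM2r ?expR_ge0 //; have /andP[lu _] := bu i x.
  by apply: le_trans lu; rewrite le_max lexx orbT.
have up x : u (i, x) * expR (- lam i * x) <= 1.
  rewrite -(gxp x) ler_wpM2r ?expR_ge0 //; have /andP[_ uu] := bu i x.
  by apply: le_trans uu _; rewrite ge_min lexx.
apply/cvgrPdist_lt => eps eps0; have q1' := q1; have q0 : 0 < q by lra.
exists (ln (eps / q) / theta); split; first exact: num_real.
move=> x xl; rewrite ger0_norm ?subr_ge0 ?up //.
have : expR (theta * x) < eps / q.
  rewrite -[ltRHS]lnK ?posrE ?divr_gt0 // ltr_expR mulrC -ltr_pdivlMr //.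
rewrite ltr_pdivlMr // => h; have := low x; lra.
Qed.

End Wave.

Lemma bounded_fun_le (R : realType) (g : R -> R) (M : R) :
  (forall x, `|g x| <= M) -> bounded_fun g.
Proof.
move=> gM; exists M; split => [|N MN x _ /=]; first exact: num_real.
exact: le_trans (gM x) (ltW MN).
Qed.

Lemma unif_continuous_dist (R : realType) (g : R -> R) :
  (forall eps : R, 0 < eps -> exists2 r : R, 0 < r &
     forall x y, `|x - y| < r -> `|g x - g y| < eps) -> unif_continuous g.
Proof.
move=> h; apply/unif_continuousP => eps eps0; have [r r0 hr] := h _ eps0.
exists r => // -[x y] /=; rewrite /ball /=; exact: hr.
Qed.

Theorem theorem5p14 (R : realType) (m tau : nat) (hm : (0 < m)%N) (htau : (0 < tau)%N)
  (e : 'I_m -> nat -> R) (f : 'I_m -> 'I_m -> nat -> R)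
  (d : 'I_m -> R) (k : 'I_m -> R -> R) (c : R)
  (he : forall (i : 'I_m) (j : nat), (1 <= j <= tau.-1)%N -> 0 <= e i j)
  (hf : forall (i l : 'I_m) (j : nat), l != i -> (1 <= j <= tau)%N -> 0 <= f i l j)
  (hd : forall i : 'I_m, 0 < d i)
  (hk : forall i : 'I_m, dispersal_kernel (k i))
  (hc : (speed_bound d k < c%:E)%E) :
  exists phi : 'I_m -> R -> R,
    [/\ forall i : 'I_m, bounded_fun (phi i) /\ unif_continuous (phi i),
        wave_system tau d e f k c phi,
        forall (i : 'I_m) (xi : R), 0 < phi i xi < 1 &
        forall i : 'I_m,
          phi i xi * expR (- lambda_c (d i) (k i) c * xi) @[xi --> -oo%R] --> (1 : R)].
Proof.
have /choice[k' hk'] : forall i, exists k', borel_kernel k' /\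
    forall g : R -> R, measurable_fun setT g -> (forall x, 0 <= g x) ->
    (\int[leb]_y (g y * k i y) = \int[lebesgue_measure]_y (g y * k' y)) /\
    (forall a, \int[leb]_y (g y * k i (a - y)) = \int[lebesgue_measure]_z (g (a - z) * k' z)).
  by move=> i; have [k' bk' h] := borel_kernel_version (hk i); exists k'.
have bk i : borel_kernel (k' i) by have [] := hk' i.
have kk i (g : R -> R) (mg : measurable_fun setT g) (g0 : forall x, 0 <= g x) := (proj2 (hk' i) g mg g0).1.
have kconv i (g : R -> R) (mg : measurable_fun setT g) (g0 : forall x, 0 <= g x) := (proj2 (hk' i) g mg g0).2.
have small i : exists2 l, 0 < l & dispersion (k' i) (d i) c l < 1 /\ 0 < c.
  by have [l l0 hl] := speed_bound_lt hc i; exists l => //; exact: (dispersion_lt1 (bk i) (kk i) (hd i) l0 hl).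
have c0 : 0 < c by have [l _ []] := small (Ordinal hm).
pose lam i := lambda_c (d i) (k i) c.
have hlam i : is_lambda_c (d i) (k i) c (lam i).
  by apply: (is_lambda_cE (bk i) (kk i) (hd i)); have [l l0 []] := small i; exists l.
have lam0 i : 0 < lam i by have [] := hlam i.
have disp_lam i : dispersion (k' i) (d i) c (lam i) = 1.
  by have [_ h _ _] := hlam i; rewrite -(LambdaE (bk i) (kk i)).
have /choice[t ht] : forall i, exists t : R, [/\ 0 < t, t <= lam i &
    forall s, 0 < s -> s <= t -> dispersion (k' i) (d i) c (lam i + s) < 1].
  move=> i; have [l0 _ _ [eta /andP[eta1 eta2] h]] := hlam i.
  (* half-way between lam i and eta * lam i, the end of the interval where Lambda < 1 *)
  exists ((eta - 1) / 2 * lam i); split; first by rewrite mulr_gt0 //; lra.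
    by rewrite ler_piMl //; lra.
  move=> s s0 st; rewrite -(LambdaE (bk i) (kk i)); apply: h; apply/andP; split; first lra.
  by nra.
pose theta := \big[Num.min/1]_i t i.
have theta0 : 0 < theta.
  by apply/bigmin_gtP; split=> [|i _]; [exact: ltr01 | have [] := ht i].
have theta_t i : theta <= t i by exact: bigmin_le_cond.
have theta_le i : theta <= lam i by have [_ h _] := ht i; exact: le_trans h.
pose W i := competition_weight tau e f c i.
pose D i := dispersion (k' i) (d i) c (lam i + theta).
have D1 i : D i < 1 by have [_ _ h] := ht i; exact: h.
(* q is chosen so large that q (1 - D i) absorbs the quadratic term for every species *)
pose a i := d i * (1 + W i) * D i / (1 - D i).
pose q : R := 1 + \sum_i `|a i|.
have q1 : 1 <= q by rewrite lerDl sumr_ge0.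
have hq i : (q + d i * (1 + W i)) * D i <= q.
  have : a i <= q.
    rewrite /q (bigD1 i) //= addrCA (le_trans (ler_norm _)) // lerDl.
    by rewrite addr_ge0 // sumr_ge0.
  rewrite /a ler_pdivrMr ?subr_gt0 // => h; lra.
have [u Ku fu] := wave_exists c0 he hf hd bk lam0 theta0 theta_le disp_lam q1 hq.
have tu := wave_set_tame bk Ku.
exists (fun i x => u (i, x)); split=> [i|i xi|i xi|i].
- split.
    by apply: (@bounded_fun_le _ _ 1) => x; rewrite ger0_norm ?(tame_ge0 _ tu) // (tame_le1 _ tu).
  apply: unif_continuous_dist => eps eps0; have [r r0 hr] := modulus_small bk eps0.
  exists r => // x y xy; have [_ /(_ i x y) h] := Ku; apply: le_lt_trans h _; exact: hr.
- rewrite -[LHS](fu (i, xi)) /step /avg /=.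
  rewrite -(kconv i _ (measurable_repro c0 he hf hd i tu)) => [|y]; last exact: repro_ge0.
  apply: eq_Rintegral => y _; rewrite /repro /growth /competition /denominator addrA.
  by rewrite mulrAC.
- by rewrite (wave_gt0 c0 he hf hd bk theta0 q1 Ku fu)
    (wave_lt1 c0 he hf hd bk lam0 Ku fu).
- have [bu _] := Ku; exact: between_cvg bu.
Qed.
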